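(* There exist universal constants $C_0,C>0$ such that for all $n\ge3$ and all $p$ with $$\frac12\ge p\ge\frac{C_0\log n}{n\log\log n},$$ the adjacency matrix $A$ of an Erdős–Rényi graph $\mathbb G(n,p)$ satisfies $$\mathrm{Var}(\|A\|_{\mathrm{op}})\le C\,p\Big(1+\frac{(\log n)^{4}}{(np)^{4}}\Big).$$ In particular, for every constant $c>0$ there is a constant $C_c$ depending only on $c$ such that if moreover $p\ge c\log n/n$ then $\mathrm{Var}(\|A\|_{\mathrm{op}})\le C_c\,p$.
   Context: $A$ is the random symmetric $n\times n$ matrix with zero diagonal whose entries $(A_{ij})_{i<j}$ are i.i.d. Bernoulli$(p)$; $\|A\|_{\mathrm{op}}$ is its operator (spectral) norm. A constant is universal if it does not depend on $n$ or $p$. *)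

(* Defs.v *)
From HB Require Import structures.
From mathcomp Require Import all_boot all_order all_algebra.
From mathcomp Require Import all_classical all_reals all_analysis.

Set Implicit Arguments.
Unset Strict Implicit.
Unset Printing Implicit Defensive.

Import Order.TTheory GRing.Theory Num.Theory.
Import numFieldNormedType.Exports.

Local Open Scope classical_set_scope.
Local Open Scope ring_scope.

Definition l2norm (R : realType) (n : nat) (x : 'cV[R]_n) : R :=
  Num.sqrt (\sum_(i < n) x i 0 ^+ 2).

(* The library norm on ['M[R]_(m, n)] is the entrywise maximum, hence this
   separate norm, induced by the Euclidean norms. *)
Definition opnorm (R : realType) (m n : nat) (M : 'M[R]_(m, n)) : R :=
  sup [set l2norm (M *m x) | x in [set x : 'cV[R]_n | l2norm x <= 1]].

Definition mutually_independent (d d' : measure_display)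
    (T : measurableType d) (T' : measurableType d') (R : realType)
    (P : probability T R) (I : finType) (D : {set I})
    (X : I -> {RV P >-> T'}) : Prop :=
  forall (J : {set I}) (B : I -> set T'),
    J \subset D -> (forall i, i \in J -> measurable (B i)) ->
    P (\bigcap_(i in [set` J]) (X i @^-1` B i)) =
    (\prod_(i in J) P (X i @^-1` B i))%E.

(* [bernoulli_prob p] lives on [bool]; pushing it forward along
   [b |-> b%:R] gives the Bernoulli law on the reals 0 and 1. *)
Record erdos_renyi_adjacency (d : measure_display) (T : measurableType d)
    (R : realType) (P : probability T R) (n : nat) (p : R)
    (A : 'I_n -> 'I_n -> {RV P >-> R}) : Prop := ErdosRenyiAdjacency {
  er_sym : forall i j w, A i j w = A j i w;
  er_diag : forall i w, A i i w = 0;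
  er_law : forall i j : 'I_n, (i < j)%N ->
    forall B : set R, measurable B ->
    distribution P (A i j) B =
    pushforward (bernoulli_prob p) (fun b : bool => b%:R : R) B;
  er_indep : mutually_independent
    [set e : 'I_n * 'I_n | (e.1 < e.2)%N]%SET (fun e => A e.1 e.2) }.

Definition random_mx (d : measure_display) (T : measurableType d)
    (R : realType) (P : probability T R) (m n : nat)
    (A : 'I_m -> 'I_n -> {RV P >-> R}) (w : T) : 'M[R]_(m, n) :=
  \matrix_(i, j) A i j w.

(* Main.v *)
Require Import Defs.
From HB Require Import structures.
From mathcomp Require Import all_boot all_order all_algebra.
From mathcomp Require Import all_classical all_reals all_analysis.
From mathcomp Require Import measurable_realfun.
From mathcomp Require Import ring lra zify.

(** Write [d = n p], [L = ln n], and let [B] be the adjacency matrix minus its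
mean.  The variance of the norm is in fact at most [76 p] as soon as [d ^ 3]
exceeds a large constant times [L ^ 2] ([variance_opnorm_le]); the hypothesis
on [p] gives this because [(ln x) ^ 3 <= 27 x], and both conclusions follow.

The Efron-Stein inequality ([efron_stein]) bounds the variance by the sum over
the pairs [i < j] of [p (1 - p) E (Z1 - Z0) ^ 2], where [Z1] and [Z0] are the
norms with the edge [ij] present and absent.  For [v] the nonnegative unit top
eigenvector of the matrix without the edge, second order perturbation
([opnorm_add_edge]) gives
  [Z1 - Z0 <= 2 v_i v_j + (v_i ^ 2 + v_j ^ 2) / (spectral gap)].
This [v] is independent of the edge, and the squares of the first terms sum to
at most [2], as [v] is a unit vector.  Hence the variance is [O(p)] once,
outside an event of probability at most [1 / n <= p], the spectral gap is of
order [d], and the sum of the [v_i ^ 4] is in the mean [O(d ^ 2 / n)]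
([finite_variance_le]).

Spectral gap.  A vector orthogonal to the all-ones vector sees only [B], so
the gap follows from a bound of order [sqrt (d + L)] on the norm of [B], which
is much smaller than [d].  That bound ([opnorm_centered_tail]) comes from the
moment [E tr (B ^ l)] with [l] of order [d + L].  Only closed walks using each
of their edges at least twice contribute to it; grouping them by the pattern
of coincidences of their vertices, one compares with the same patterns of
walks on [r = 2 l] points ([trace_centered_le]).  The latter are counted by
[E tr (Y ^ l)], for [Y] a symmetric matrix of size [r] with independent
entries equal to [2] or [-1], and the norm of [Y] is controlled by a grid on
the unit ball, whose cardinality, exponential in [r], is affordable since [r]
and [l] are of the same order ([skewed_trace_moment]).

Delocalization.  Let [w] be the top eigenvector after the edges at [i] have
been removed; it is independent of these edges.  The gap makes [v] close to
[w] off the coordinate [i], with an error proportional to [v_i] itself, so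
that [v_i <= (2 / d) sum_j A_ij w_j] ([leave_one_out]).  Taking the mean of
fourth powers bounds the mean of [sum_i v_i ^ 4] by a small multiple of itself
plus [O(d / n)] ([delocalization]).

All this takes place on the finite space of edge indicators; the law and the
independence of the entries transfer it to the given random matrix
([variance_opnorm_finite]). *)

Set Implicit Arguments.
Unset Strict Implicit.
Unset Printing Implicit Defensive.

Import Order.TTheory GRing.Theory Num.Theory.
Import numFieldNormedType.Exports.

Local Open Scope ring_scope.

(** * Product Bernoulli measures and the Efron-Stein inequality *)

Section BernoulliProduct.
Variables (R : realFieldType) (I : finType) (q : I -> R).
Implicit Types (w : {ffun I -> bool}) (f g : {ffun I -> bool} -> R) (e : I).

(** The mass of [w] when its coordinates are independent and
coordinate [e] is true with probability [q e]. *)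
Definition bern_weight w : R := \prod_e (if w e then q e else 1 - q e).

(** The expectation under that product measure, as a finite sum. *)
Definition bern_mean f : R := \sum_w bern_weight w * f w.

(** The configuration [w] with its coordinate [e] set to [b]. *)
Definition set_coord e (b : bool) w : {ffun I -> bool} :=
  [ffun x => if x == e then b else w x].

(** The conditional expectation of [f] given all coordinates but [e]. *)
Definition coord_avg e f w : R :=
  q e * f (set_coord e true w) + (1 - q e) * f (set_coord e false w).

(** The discrete derivative of [f] in the coordinate [e]. *)
Definition coord_diff e f w : R :=
  f (set_coord e true w) - f (set_coord e false w).

Local Notation E := bern_mean.

Lemma set_coord_id e w : set_coord e (w e) w = w.
Proof. by apply/ffunP=> x; rewrite ffunE; case: eqP => [->|]. Qed.

Lemma set_coordK e b b' w : set_coord e b (set_coord e b' w) = set_coord e b w.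
Proof. by apply/ffunP=> x; rewrite !ffunE; case: eqP. Qed.

Lemma set_coordC e e' b b' w : e != e' ->
  set_coord e b (set_coord e' b' w) = set_coord e' b' (set_coord e b w).
Proof.
move=> ne; apply/ffunP=> x; rewrite !ffunE.
by case: (eqVneq x e) => [->|//]; rewrite (negbTE ne).
Qed.

Lemma set_coord_eq e b w : set_coord e b w e = b.
Proof. by rewrite ffunE eqxx. Qed.

Lemma bern_mean_avg e f : E f = E (coord_avg e f).
Proof.
pose rest w := \prod_(x | x != e) (if w x then q x else 1 - q x).
have wE w : bern_weight w = (if w e then q e else 1 - q e) * rest w.
  by rewrite /bern_weight (bigD1 e).
have restE b w : rest (set_coord e b w) = rest w.
  by apply: eq_bigr => x /negbTE ne; rewrite ffunE ne.
have reidx (F : {ffun I -> bool} -> R) :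
    \sum_(w : {ffun I -> bool} | w e) F w = \sum_(w : {ffun I -> bool} | ~~ w e) F (set_coord e true w).
  rewrite (reindex_onto (set_coord e true) (set_coord e false)) /=; last first.
    by move=> w we; rewrite set_coordK -{1}we set_coord_id.
  apply: eq_bigl => w; rewrite set_coord_eq set_coordK /=.
  apply/eqP/idP => [<-|/negbTE we]; first by rewrite set_coord_eq.
  by rewrite -{1}we set_coord_id.
rewrite /bern_mean !(bigID (fun w : {ffun I -> bool} => w e) predT) /= !reidx -!big_split /=.
apply: eq_bigr => w /negbTE we; rewrite /coord_avg !wE !set_coordK !set_coord_eq.
rewrite !restE we.
have -> : set_coord e false w = w by rewrite -{1}we set_coord_id.
ring.
Qed.

Lemma eq_bern_mean f g : f =1 g -> E f = E g.
Proof. by move=> fg; apply: eq_bigr => w _; rewrite fg. Qed.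

Lemma bern_meanD f g : E (fun w => f w + g w) = E f + E g.
Proof. by rewrite -big_split; apply: eq_bigr => w _; rewrite mulrDr. Qed.

Lemma bern_meanZ c f : E (fun w => c * f w) = c * E f.
Proof. by rewrite mulr_sumr; apply: eq_bigr => w _; rewrite mulrCA. Qed.

Lemma bern_meanB f g : E (fun w => f w - g w) = E f - E g.
Proof. by rewrite -sumrB; apply: eq_bigr => w _; rewrite mulrBr. Qed.

Lemma bern_mean_sum (J : Type) (r : seq J) (P : pred J)
    (F : J -> {ffun I -> bool} -> R) :
  E (fun w => \sum_(j <- r | P j) F j w) = \sum_(j <- r | P j) E (F j).
Proof.
rewrite exchange_big; apply: eq_bigr => w _.
by rewrite mulr_sumr.
Qed.

Lemma bern_mean_prod (h : I -> bool -> R) :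
  E (fun w => \prod_e h e (w e)) =
  \prod_e (q e * h e true + (1 - q e) * h e false).
Proof.
pose F e (b : bool) := (if b then q e else 1 - q e) * h e b.
transitivity (\prod_e \sum_b F e b); last first.
  by apply: eq_bigr => e _; rewrite big_bool.
rewrite bigA_distr_bigA; apply: eq_bigr => w _.
by rewrite /bern_weight -big_split.
Qed.

Lemma bern_mean_cst c : E (fun=> c) = c.
Proof.
rewrite -[RHS]mulr1.
have -> : E (fun=> c) = c * E (fun w => \prod_(e : I) 1).
  by rewrite -bern_meanZ; apply: eq_bern_mean => w; rewrite big1 ?mulr1.
rewrite (bern_mean_prod (fun=> fun=> 1)) big1 // => e _; ring.
Qed.

(** A coordinate is independent of any function that does not depend on it. *)
Lemma bern_mean_coord e g : (forall w b, g (set_coord e b w) = g w) ->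
  E (fun w => (w e)%:R * g w) = q e * E g.
Proof.
move=> ge; rewrite (bern_mean_avg e) -bern_meanZ; apply: eq_bern_mean => w.
by rewrite /coord_avg !set_coord_eq !ge /= mul0r mulr0 addr0 mul1r.
Qed.

Hypothesis q01 : forall e, 0 <= q e <= 1.

Lemma bern_weight_ge0 w : 0 <= bern_weight w.
Proof.
apply: prodr_ge0 => e _; case: ifP => _; have /andP[] := q01 e; lra.
Qed.

Lemma ler_bern_mean f g : (forall w, f w <= g w) -> E f <= E g.
Proof.
by move=> fg; apply: ler_sum => w _; rewrite ler_wpM2l ?bern_weight_ge0.
Qed.

Lemma bern_mean_ge0 f : (forall w, 0 <= f w) -> 0 <= E f.
Proof. by move=> f0; rewrite -(bern_mean_cst 0) ler_bern_mean. Qed.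

(** Averaging over one coordinate decreases the second moment by the mean
conditional variance along that coordinate. *)
Lemma bern_mean_step e f :
  E (fun w => f w ^+ 2) - E (fun w => coord_avg e f w ^+ 2) =
  q e * (1 - q e) * E (fun w => coord_diff e f w ^+ 2).
Proof.
rewrite (bern_mean_avg e) -bern_meanB -bern_meanZ; apply: eq_bern_mean => w.
rewrite /coord_avg /coord_diff; ring.
Qed.

(** Averaging over a coordinate does not increase the other influences: this
is Jensen's inequality, as the two operations commute. *)
Lemma coord_diff_avg_le e e' f :
  E (fun w => coord_diff e' (coord_avg e f) w ^+ 2) <=
  E (fun w => coord_diff e' f w ^+ 2).
Proof.
have [->|ne] := eqVneq e' e.
  apply: ler_bern_mean => w.
  by rewrite {1}/coord_diff /coord_avg !set_coordK subrr expr0n sqr_ge0.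
rewrite [leRHS](bern_mean_avg e); apply: ler_bern_mean => w.
rewrite /coord_diff /coord_avg !(set_coordC _ _ _ ne).
set a := f (set_coord e true (set_coord e' true w)).
set b := f (set_coord e false (set_coord e' true w)).
set c := f (set_coord e true (set_coord e' false w)).
set d := f (set_coord e false (set_coord e' false w)).
have /andP[q0 q1] := q01 e.
rewrite -subr_ge0.
have -> : q e * (a - c) ^+ 2 + (1 - q e) * (b - d) ^+ 2 -
  (q e * a + (1 - q e) * b - (q e * c + (1 - q e) * d)) ^+ 2 =
  (q e * (1 - q e)) * ((a - c) - (b - d)) ^+ 2 by ring.
by rewrite mulr_ge0 ?sqr_ge0 // mulr_ge0 // subr_ge0.
Qed.

(** Averaging the coordinates out one after the other turns [f] into its
mean; the second moment lost at each step is at most the influence of that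
coordinate on [f] itself. *)
Lemma efron_stein f :
  E (fun w => (f w - E f) ^+ 2) <=
  \sum_e q e * (1 - q e) * E (fun w => coord_diff e f w ^+ 2).
Proof.
pose avg s := foldr coord_avg f s.
have inv s e w b : e \in s -> avg s (set_coord e b w) = avg s w.
  elim: s e w b => [//|e' s IH] e w b /=; rewrite inE /coord_avg.
  have [-> _|ne /=] := eqVneq e e'; first by rewrite !set_coordK.
  by rewrite eq_sym in ne; move=> es; rewrite !(set_coordC _ _ _ ne) !(IH _ _ _ es).
have meanE s : E (avg s) = E f by elim: s => //= e s <-; rewrite -bern_mean_avg.
have diff_le s e : E (fun w => coord_diff e (avg s) w ^+ 2) <=
    E (fun w => coord_diff e f w ^+ 2).
  by elim: s => //= e' s; apply: le_trans; apply: coord_diff_avg_le.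
have main s : E (fun w => f w ^+ 2) - E (fun w => avg s w ^+ 2) <=
    \sum_(e <- s) q e * (1 - q e) * E (fun w => coord_diff e f w ^+ 2).
  elim: s => [|e s IH]; first by rewrite /= subrr big_nil.
  rewrite big_cons /=.
  have := bern_mean_step e (avg s); rewrite /= -/(avg s).
  have /andP[q0 q1] := q01 e.
  have : q e * (1 - q e) * E (fun w => coord_diff e (avg s) w ^+ 2) <=
     q e * (1 - q e) * E (fun w => coord_diff e f w ^+ 2).
    by rewrite ler_wpM2l // mulr_ge0 // subr_ge0.
  lra.
pose s := enum I.
have cst w : avg s w = E f.
  (* Once all coordinates are averaged out, the function is constant. *)
  have const w1 w2 : avg s w1 = avg s w2.
    have : forall t : seq I, {in t, forall e, e \in s} ->
        avg s w1 = avg s [ffun x => if x \in t then w2 x else w1 x].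
      elim=> [_|e t IH ts].
        by congr (avg s _); apply/ffunP=> x; rewrite ffunE.
      rewrite IH => [|x xt]; last by rewrite ts // inE xt orbT.
      rewrite -(inv s e _ (w2 e)) ?ts ?inE ?eqxx //; congr (avg s _).
      by apply/ffunP=> x; rewrite !ffunE inE; case: eqP => [->|].
    move=> /(_ s) ->; last by [].
    by congr (avg s _); apply/ffunP=> x; rewrite ffunE mem_enum.
  by rewrite -(meanE s) -(bern_mean_cst (avg s w)); apply: eq_bern_mean.
have -> : E (fun w => (f w - E f) ^+ 2) = E (fun w => f w ^+ 2) - E f ^+ 2.
  have -> : E (fun w => (f w - E f) ^+ 2) =
     E (fun w => f w ^+ 2 - 2 * E f * f w + E f ^+ 2).
    by apply: eq_bern_mean => w; ring.
  rewrite bern_meanD bern_meanB bern_meanZ bern_mean_cst; ring.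
have := main s; rewrite (eq_bern_mean (f := fun w => avg s w ^+ 2)
  (g := fun=> E f ^+ 2)); last by move=> w; rewrite cst.
by rewrite bern_mean_cst big_enum.
Qed.

End BernoulliProduct.

(** * Euclidean norm, operator norm and quadratic forms *)

Section Euclid.
Local Open Scope classical_set_scope.
Local Open Scope ring_scope.
Variable R : realType.

(** The Euclidean inner product of column vectors. *)
Definition dot n (x y : 'cV[R]_n) : R := \sum_i x i 0 * y i 0.

Lemma dotC n (x y : 'cV[R]_n) : dot x y = dot y x.
Proof. by apply: eq_bigr => i _; rewrite mulrC. Qed.

Lemma dotDl n (x y z : 'cV[R]_n) : dot (x + y) z = dot x z + dot y z.
Proof. by rewrite -big_split; apply: eq_bigr => i _; rewrite mxE mulrDl. Qed.

Lemma dotDr n (x y z : 'cV[R]_n) : dot z (x + y) = dot z x + dot z y.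
Proof. by rewrite dotC dotDl !(dotC z). Qed.

Lemma dotZl n a (x y : 'cV[R]_n) : dot (a *: x) y = a * dot x y.
Proof. by rewrite mulr_sumr; apply: eq_bigr => i _; rewrite mxE mulrA. Qed.

Lemma dotZr n a (x y : 'cV[R]_n) : dot x (a *: y) = a * dot x y.
Proof. by rewrite dotC dotZl dotC. Qed.

Lemma dotNl n (x y : 'cV[R]_n) : dot (- x) y = - dot x y.
Proof. by rewrite -scaleN1r dotZl mulN1r. Qed.

Lemma dotNr n (x y : 'cV[R]_n) : dot y (- x) = - dot y x.
Proof. by rewrite dotC dotNl dotC. Qed.

Lemma dotBl n (x y z : 'cV[R]_n) : dot (x - y) z = dot x z - dot y z.
Proof. by rewrite dotDl dotNl. Qed.

Lemma dotBr n (x y z : 'cV[R]_n) : dot z (x - y) = dot z x - dot z y.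
Proof. by rewrite dotDr dotNr. Qed.

Lemma dot0l n (x : 'cV[R]_n) : dot 0 x = 0.
Proof. by rewrite -(scale0r 0) dotZl mul0r. Qed.

Lemma dot0r n (x : 'cV[R]_n) : dot x 0 = 0.
Proof. by rewrite dotC dot0l. Qed.

Definition dotE := (dotDl, dotDr, dotBl, dotBr, dotNl, dotNr, dotZl, dotZr).

Lemma dot_mulmx m n (M : 'M[R]_(m, n)) (x : 'cV_m) (y : 'cV_n) :
  dot x (M *m y) = \sum_i \sum_j x i 0 * M i j * y j 0.
Proof.
apply: eq_bigr => i _; rewrite mxE mulr_sumr.
by apply: eq_bigr => j _; rewrite mulrA.
Qed.

Lemma dot_tr m n (M : 'M[R]_(m, n)) x y : dot x (M *m y) = dot (M^T *m x) y.
Proof.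
rewrite [RHS]dotC !dot_mulmx exchange_big; apply: eq_bigr => i _.
by apply: eq_bigr => j _; rewrite mxE; ring.
Qed.

Lemma dot_ge0 n (x : 'cV[R]_n) : 0 <= dot x x.
Proof. by apply: sumr_ge0 => i _; rewrite -expr2 sqr_ge0. Qed.

Lemma dot_eq0 n (x : 'cV[R]_n) : dot x x = 0 -> x = 0.
Proof.
move=> /eqP; rewrite psumr_eq0 => [/allP x0|i _]; last first.
  by rewrite -expr2 sqr_ge0.
apply/matrixP=> i j; rewrite ord1 mxE; apply/eqP.
by have := x0 i (mem_index_enum _); rewrite /= mulf_eq0 orbb.
Qed.

Lemma cauchy_schwarz n (x y : 'cV[R]_n) : dot x y ^+ 2 <= dot x x * dot y y.
Proof.
have [y0|y0] := eqVneq (dot y y) 0.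
  by rewrite (dot_eq0 y0) !dot0r mulr0 expr0n.
have yp : 0 < dot y y by rewrite lt_def y0 dot_ge0.
have := dot_ge0 (dot y y *: x - dot x y *: y).
rewrite !dotE !(dotC y x) => H.
have : 0 <= dot y y * (dot x x * dot y y - dot x y ^+ 2) by lra.
by rewrite pmulr_rge0 // subr_ge0.
Qed.

Lemma l2normE n (x : 'cV[R]_n) : l2norm x = Num.sqrt (dot x x).
Proof. by congr Num.sqrt; apply: eq_bigr => i _; rewrite expr2. Qed.

Lemma l2norm_sq n (x : 'cV[R]_n) : l2norm x ^+ 2 = dot x x.
Proof. by rewrite l2normE sqr_sqrtr ?dot_ge0. Qed.

Lemma l2norm_ge0 n (x : 'cV[R]_n) : 0 <= l2norm x.
Proof. by rewrite l2normE sqrtr_ge0. Qed.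

Lemma l2normZ n a (x : 'cV[R]_n) : l2norm (a *: x) = `|a| * l2norm x.
Proof.
rewrite !l2normE dotZl dotZr mulrA -expr2 sqrtrM ?sqr_ge0 //.
by rewrite sqrtr_sqr.
Qed.

Lemma dot_le_l2norm n (x y : 'cV[R]_n) : dot x y <= l2norm x * l2norm y.
Proof.
apply: le_trans (ler_norm _) _.
rewrite -ler_sqr ?nnegrE ?mulr_ge0 ?l2norm_ge0 //.
by rewrite real_normK ?num_real // exprMn !l2norm_sq cauchy_schwarz.
Qed.

Lemma l2norm_le n (x : 'cV[R]_n) c : 0 <= c -> (l2norm x <= c) = (dot x x <= c ^+ 2).
Proof. by move=> c0; rewrite -l2norm_sq ler_sqr ?nnegrE ?l2norm_ge0. Qed.

Lemma frobenius_bound m n (M : 'M[R]_(m, n)) x :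
  dot (M *m x) (M *m x) <= (\sum_i \sum_j M i j ^+ 2) * dot x x.
Proof.
rewrite mulr_suml; apply: ler_sum => i _.
have -> : (M *m x) i 0 = dot (row i M)^T x.
  by rewrite mxE; apply: eq_bigr => j _; rewrite !mxE.
rewrite -expr2; apply: le_trans (cauchy_schwarz _ _) _.
rewrite ler_wpM2r ?dot_ge0 //; apply: ler_sum => j _.
by rewrite !mxE -expr2.
Qed.

Lemma opnorm_has_sup m n (M : 'M[R]_(m, n)) :
  has_sup [set l2norm (M *m x) | x in [set x : 'cV[R]_n | l2norm x <= 1]].
Proof.
split.
  exists (l2norm (M *m 0)), 0 => //=.
  by rewrite l2norm_le // dot0l expr1n.
exists (Num.sqrt (\sum_i \sum_j M i j ^+ 2)) => _ [x /= x1 <-].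
have S0 : 0 <= \sum_i \sum_j M i j ^+ 2.
  by apply: sumr_ge0 => i _; apply: sumr_ge0 => j _; rewrite sqr_ge0.
rewrite l2norm_le ?sqrtr_ge0 // sqr_sqrtr //.
apply: le_trans (frobenius_bound _ _) _.
by rewrite l2norm_le // expr1n in x1; rewrite ler_piMr.
Qed.

Lemma opnorm_ge0 m n (M : 'M[R]_(m, n)) : 0 <= opnorm M.
Proof.
apply: le_trans (l2norm_ge0 (M *m 0)) _.
apply: (ub_le_sup (proj2 (opnorm_has_sup M))); exists 0 => //=.
by rewrite l2norm_le // dot0l expr1n.
Qed.

Lemma l2norm_opnorm m n (M : 'M[R]_(m, n)) x :
  l2norm (M *m x) <= opnorm M * l2norm x.
Proof.
have [x0|x0] := eqVneq (l2norm x) 0.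
  have -> : x = 0 by apply: dot_eq0; rewrite -l2norm_sq x0 expr0n.
  by rewrite mulmx0 l2normE dot0l sqrtr0 mulr_ge0 ?opnorm_ge0 ?l2norm_ge0.
have xp : 0 < l2norm x by rewrite lt_def x0 l2norm_ge0.
have : l2norm (M *m ((l2norm x)^-1 *: x)) <= opnorm M.
  apply: (ub_le_sup (proj2 (opnorm_has_sup M))).
  exists ((l2norm x)^-1 *: x) => //=.
  by rewrite l2normZ ger0_norm ?invr_ge0 ?l2norm_ge0 // mulVf.
rewrite -scalemxAr l2normZ ger0_norm ?invr_ge0 ?l2norm_ge0 //.
by rewrite ler_pdivrMl // mulrC.
Qed.

Lemma opnorm_le m n (M : 'M[R]_(m, n)) c : 0 <= c ->
  (forall x, l2norm (M *m x) <= c * l2norm x) -> opnorm M <= c.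
Proof.
move=> c0 H; apply: ge_sup; first by case: (opnorm_has_sup M).
move=> _ [x /= x1 <-]; apply: le_trans (H x) _.
by rewrite ler_piMr.
Qed.

Lemma dot_opnorm n (M : 'M[R]_n) x : dot x (M *m x) <= opnorm M * dot x x.
Proof.
apply: le_trans (dot_le_l2norm _ _) _; rewrite -l2norm_sq expr2.
by rewrite mulrCA ler_wpM2l ?l2norm_ge0 // l2norm_opnorm.
Qed.

(** A quadratic form attains its maximum on the unit sphere, by compactness. *)
Lemma quadratic_form_max n (M : 'M[R]_n) : (0 < n)%N ->
  exists2 v : 'cV[R]_n, dot v v = 1 &
    forall x : 'cV[R]_n, dot x (M *m x) <= dot v (M *m v) * dot x x.
Proof.
move=> n0.
have cont_form (N : 'M[R]_n) :
    continuous (fun x : 'rV[R]_n => dot x^T (N *m x^T)).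
  have -> : (fun x : 'rV[R]_n => dot x^T (N *m x^T)) =
      fun x => \sum_i \sum_j x 0 i * N i j * x 0 j.
    apply/funext => x; rewrite dot_mulmx; apply: eq_bigr => i _.
    by apply: eq_bigr => j _; rewrite !mxE.
  apply: continuous_big; first exact: add_continuous.
  move=> i _; apply: continuous_big; first exact: add_continuous.
  move=> j _ x.
  apply: (@continuousM _ _ (fun y : 'rV[R]_n => y 0 i * N i j)
    (fun y => y 0 j) x); last exact: coord_continuous.
  apply: (@continuousM _ _ (fun y : 'rV[R]_n => y 0 i) (fun=> N i j) x).
    exact: coord_continuous.
  exact: cst_continuous.
pose S := [set x : 'rV[R]_n | dot x^T x^T = 1].
have Scont : continuous (fun x : 'rV[R]_n => dot x^T x^T).
  have -> : (fun x : 'rV[R]_n => dot x^T x^T) =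
      (fun x : 'rV[R]_n => dot x^T (1%:M *m x^T)).
    by apply/funext => x; rewrite mul1mx.
  exact: cont_form.
have Scompact : compact S.
  apply: (@subclosed_compact _ S
    [set v : 'rV[R]_n | forall i, `[(-1), 1]%classic (v ord0 i)]).
  - by apply: closed_comp (@closed_eq _ 1) => x _; exact: Scont.
  - have := @rV_compact _ n (fun=> `[(-1 : R), 1]%classic).
    by apply => i; exact: segment_compact.
  - move=> v Sv i /=; rewrite in_itv /= -ler_norml.
    rewrite -(@ler_sqr _ _ 1) ?nnegrE // real_normK ?num_real // expr1n -[leRHS]Sv.
    rewrite /dot (bigD1 i) //= !mxE -expr2 lerDl.
    by apply: sumr_ge0 => j _; rewrite -expr2 sqr_ge0.
have S0 : S !=set0.
  exists (delta_mx 0 (Ordinal n0)); rewrite /S /= /dot (bigD1 (Ordinal n0)) //=.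
  rewrite !mxE !eqxx mulr1 big1 ?addr0 // => j /negbTE ne.
  by rewrite !mxE ne andbF mul0r.
have [c cS cmax] := EVT_max_rV S0 Scompact (continuous_subspaceT (cont_form M)).
exists c^T; first by move: cS; rewrite inE.
move=> x; have [/dot_eq0 ->|x0] := eqVneq (dot x x) 0.
  by rewrite mulmx0 !dot0r mulr0.
have xp : 0 < dot x x by rewrite lt_def x0 dot_ge0.
pose a := (l2norm x)^-1; have a2 : a ^+ 2 = (dot x x)^-1.
  by rewrite exprVn l2norm_sq.
have := cmax (a *: x)^T; rewrite inE /S /= trmxK !(dotZl, dotZr) -scalemxAr dotZr.
rewrite !mulrA -expr2 a2 mulVf // => /(_ erefl).
by rewrite mulrC ler_pdivrMr.
Qed.

End Euclid.

(** * The top eigenvector, spectral gap and edge perturbation *)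

Section TopVector.
Local Open Scope classical_set_scope.
Local Open Scope ring_scope.
Variable R : realType.

(** A nonnegative unit eigenvector for the operator norm, as given by the
Perron-Frobenius theorem. *)
Definition top_vector_of n (A : 'M[R]_n) (v : 'cV[R]_n) : Prop :=
  [/\ forall i, 0 <= v i 0, dot v v = 1 & A *m v = opnorm A *: v].

(** For a symmetric matrix the quadratic form controls the operator norm, by
polarization. *)
Lemma opnorm_quadratic n (A : 'M[R]_n) l : 0 <= l -> A^T = A ->
  (forall x, `|dot x (A *m x)| <= l * dot x x) -> opnorm A <= l.
Proof.
move=> l0 symA Al; apply: opnorm_le => // x.
(* Polarization, with the parallelogram law. *)
have polar (y z : 'cV[R]_n) :
    2 * dot y (A *m z) <= l * (dot y y + dot z z).
  have := Al (y + z); have := Al (y - z); rewrite !ler_norml.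
  move=> /andP[H1 _] /andP[_ H2].
  have zy : dot z (A *m y) = dot y (A *m z) by rewrite dot_tr symA dotC.
  move: H1 H2; rewrite !mulmxDr !mulmxN !dotE zy (dotC z y); lra.
set y := A *m x.
rewrite -ler_sqr ?nnegrE ?mulr_ge0 ?l2norm_ge0 // exprMn !l2norm_sq.
have [l0'|l0'] := eqVneq l 0.
  have := polar y x; rewrite l0' expr2 !mul0r.
  have := dot_ge0 y; rewrite -/y; lra.
have lp : 0 < l by rewrite lt_def l0'.
have := polar (l^-1 *: y) x; rewrite !dotE -/y => H.
have : l * (2 * (l^-1 * dot y y)) <=
       l * (l * (l^-1 * (l^-1 * dot y y) + dot x x)) by rewrite ler_wpM2l.
have -> : l * (2 * (l^-1 * dot y y)) = 2 * dot y y by field.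
have -> : l * (l * (l^-1 * (l^-1 * dot y y) + dot x x)) =
  dot y y + l ^+ 2 * dot x x by field.
lra.
Qed.

Lemma dot_mulmx_ge0 n (A : 'M[R]_n) (x y : 'cV[R]_n) : (forall i j, 0 <= A i j) ->
  (forall i, 0 <= x i 0) -> (forall i, 0 <= y i 0) -> 0 <= dot x (A *m y).
Proof.
move=> A0 x0 y0; rewrite dot_mulmx; apply: sumr_ge0 => i _.
by apply: sumr_ge0 => j _; rewrite !mulr_ge0.
Qed.

(** The entrywise absolute value of a maximizer of the quadratic form is again
a maximizer, since the entries of [A] are nonnegative. *)
Lemma top_vector_exists n (A : 'M[R]_n) : (0 < n)%N -> A^T = A ->
  (forall i j, 0 <= A i j) -> exists v, top_vector_of A v.
Proof.
move=> n0 symA A0; have [u u1 umax] := quadratic_form_max A n0.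
pose absv (x : 'cV[R]_n) : 'cV[R]_n := \col_i `|x i 0|.
have absv_dot x : dot (absv x) (absv x) = dot x x.
  by apply: eq_bigr => i _; rewrite !mxE -expr2 real_normK ?num_real // expr2.
have absv_form x : `|dot x (A *m x)| <= dot (absv x) (A *m absv x).
  rewrite !dot_mulmx; apply: le_trans (ler_norm_sum _ _ _) _.
  apply: ler_sum => i _; apply: le_trans (ler_norm_sum _ _ _) _.
  by apply: ler_sum => j _; rewrite !mxE !normrM (ger0_norm (A0 _ _)).
pose v := absv u; pose l := dot v (A *m v).
have v1 : dot v v = 1 by rewrite absv_dot.
have v0 i : 0 <= v i 0 by rewrite mxE.
have l0 : 0 <= l by apply: dot_mulmx_ge0.
have lE x : dot x (A *m x) <= l * dot x x.
  apply: le_trans (umax x) _; rewrite ler_wpM2r ?dot_ge0 //.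
  exact: le_trans (ler_norm _) (absv_form u).
have opl : opnorm A = l.
  apply/eqP; rewrite eq_le; apply/andP; split.
    apply: opnorm_quadratic => // x; apply: le_trans (absv_form x) _.
    by rewrite -(absv_dot x).
  by have := dot_opnorm A v; rewrite v1 mulr1.
exists v; split=> //; rewrite opl.
apply/eqP; rewrite -subr_eq0; apply/eqP/dot_eq0/le_anti; rewrite dot_ge0 andbT.
have : dot (A *m v) (A *m v) <= l ^+ 2.
  rewrite -l2norm_sq ler_sqr ?nnegrE ?l2norm_ge0 //.
  by apply: le_trans (l2norm_opnorm _ _) _; rewrite l2normE v1 sqrtr1 mulr1 opl.
rewrite !dotE v1 (dotC (A *m v) v) -/l; lra.
Qed.

(** A choice of such an eigenvector, depending on the matrix only; the value is
[0] when there is none. *)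
Definition top_vector n (A : 'M[R]_n) : 'cV[R]_n :=
  xget 0 [set v | top_vector_of A v].

Lemma top_vectorP n (A : 'M[R]_n) : (0 < n)%N -> A^T = A ->
  (forall i j, 0 <= A i j) -> top_vector_of A (top_vector A).
Proof.
move=> n0 symA A0; rewrite /top_vector; case: xgetP => // H.
by have [v] := top_vector_exists n0 symA A0; move=> /H.
Qed.

Lemma top_vector_opnorm n (A : 'M[R]_n) v : top_vector_of A v ->
  dot v (A *m v) = opnorm A.
Proof. by case=> _ v1 ->; rewrite dotZr v1 mulr1. Qed.

Lemma opnorm_diff_le n (A A' : 'M[R]_n) v : top_vector_of A' v ->
  opnorm A' - opnorm A <= dot v ((A' - A) *m v).
Proof.
move=> tv; have := dot_opnorm A v; case: (tv) => _ v1 _.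
by rewrite v1 mulr1 mulmxBl dotBr (top_vector_opnorm tv) lerD2l lerN2.
Qed.

Lemma opnorm_mono n (A A' : 'M[R]_n) : (0 < n)%N -> A^T = A ->
  (forall i j, 0 <= A i j) -> (forall i j, A i j <= A' i j) ->
  opnorm A <= opnorm A'.
Proof.
move=> n0 symA A0 AA'; have [v tv] := top_vector_exists n0 symA A0.
have := opnorm_diff_le A' tv; case: tv => v0 _ _.
have : 0 <= dot v ((A' - A) *m v).
  by apply: dot_mulmx_ge0 => // i j; rewrite !mxE subr_ge0.
rewrite -(opprB A') mulNmx dotNr; lra.
Qed.

Definition ones n : 'cV[R]_n := const_mx 1.

Lemma dot_onesE n (x : 'cV[R]_n) : dot (ones n) x = \sum_i x i 0.
Proof. by apply: eq_bigr => i _; rewrite mxE mul1r. Qed.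

Lemma top_vector_sum_gt0 n (A : 'M[R]_n) v : top_vector_of A v ->
  0 < dot (ones n) v.
Proof.
case=> v0 v1 _; rewrite dot_onesE lt_def sumr_ge0 // andbT.
apply: contraPneq v1; move=> /eqP; rewrite psumr_eq0 // => /allP vz.
rewrite /dot big1 => [/esym/eqP|i _]; first by rewrite oner_eq0.
by have /eqP -> := vz i (mem_index_enum _); rewrite mul0r.
Qed.

(** If [N] has the eigenvalue [l >= s] at [v] and its quadratic form is at
most [s] on the vectors of the span of [v] and [z] orthogonal to the all-ones
vector, then it is at most [s] at [z] as well, provided [v] is not itself
orthogonal to the all-ones vector. *)
Lemma spectral_gap n (N : 'M[R]_n) l v z s : N^T = N -> N *m v = l *: v ->
  dot v v = 1 -> dot v z = 0 -> s <= l -> 0 < dot (ones n) v ->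
  (forall a b, let y := a *: v + b *: z in
     dot (ones n) y = 0 -> dot y (N *m y) <= s * dot y y) ->
  dot z (N *m z) <= s * dot z z.
Proof.
move=> symN Nv v1 vz sl onev H.
pose a := dot (ones n) z; pose b := dot (ones n) v.
(* This combination of [v] and [z] is orthogonal to the all-ones vector. *)
have /H : dot (ones n) (a *: v + (- b) *: z) = 0 by rewrite !dotE /a /b; ring.
rewrite mulmxDr -!scalemxAr !dotE.
have -> : dot v (N *m z) = 0 by rewrite dot_tr symN Nv dotZl vz mulr0.
rewrite Nv !dotE (dotC z v) vz v1 => Hy.
have : b ^+ 2 * (dot z (N *m z) - s * dot z z) <= a ^+ 2 * (s - l) by lra.
have : a ^+ 2 * (s - l) <= 0 by rewrite mulr_ge0_le0 ?sqr_ge0 // subr_le0.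
move=> h1 h2; have := le_trans h2 h1.
by rewrite pmulr_rle0 ?exprn_gt0 // subr_le0.
Qed.

(** The adjacency matrix of the single edge [ij]. *)
Definition edge_mx n (i j : 'I_n) : 'M[R]_n := delta_mx i j + delta_mx j i.

Lemma dot_edge_mx n (i j : 'I_n) (x y : 'cV[R]_n) :
  dot x (edge_mx i j *m y) = x i 0 * y j 0 + x j 0 * y i 0.
Proof.
have aux (k l : 'I_n) : dot x (delta_mx k l *m y) = x k 0 * y l 0.
  rewrite dot_mulmx (bigD1 k) //= (bigD1 l) //= !mxE !eqxx mulr1.
  rewrite !big1 ?addr0 // => [k' /negbTE ne|l' /negbTE ne].
    by rewrite big1 // => l' _; rewrite mxE ne mulr0 mul0r.
  by rewrite mxE ne andbF mulr0 mul0r.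
by rewrite mulmxDl dotDr !aux.
Qed.

Lemma dot_ge_two n (x : 'cV[R]_n) i j : i != j ->
  x i 0 ^+ 2 + x j 0 ^+ 2 <= dot x x.
Proof.
move=> ne; rewrite /dot (bigD1 i) //= (bigD1 j) 1?eq_sym //= -!expr2 addrA lerDl.
by apply: sumr_ge0 => k _; rewrite -expr2 sqr_ge0.
Qed.

(** Second order perturbation bound for the norm when an edge is added; the
hypothesis on the vectors orthogonal to [v] is the spectral gap. *)
Lemma opnorm_add_edge n (A : 'M[R]_n) i j v s : (0 < n)%N -> i != j ->
  A^T = A -> (forall i j, 0 <= A i j) -> top_vector_of A v ->
  (forall z, dot v z = 0 -> dot z (A *m z) <= s * dot z z) ->
  s + 1 < opnorm A ->
  opnorm (A + edge_mx i j) - opnorm A <= 2 * v i 0 * v j 0 +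
    (v i 0 ^+ 2 + v j 0 ^+ 2) / (opnorm A - s - 1).
Proof.
move=> n0 ij symA A0 tv gap; set l := opnorm A => sl.
have E0 (k m : 'I_n) : 0 <= (A + edge_mx i j) k m.
  by rewrite !mxE; do ?[apply: addr_ge0 => //]; rewrite ler0n.
have symE : (A + edge_mx i j)^T = A + edge_mx i j.
  by rewrite !linearD /= symA !trmx_delta (addrC (delta_mx j i)).
have [x tx] := top_vector_exists n0 symE E0.
rewrite -(top_vector_opnorm tx) mulmxDl dotDr.
have [_ x1 _] := tx; have [v0 v1 Av] := tv.
pose a := dot v x; pose z := x - a *: v.
have vz : dot v z = 0 by rewrite /z !dotE v1 /a; ring.
have xE : x = a *: v + z by rewrite /z addrC subrK.
clearbody z.
have az : a ^+ 2 + dot z z = 1.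
  have : dot (a *: v + z) (a *: v + z) = 1 by rewrite -xE.
  by rewrite !dotE v1 (dotC z v) vz => <-; ring.
have zz0 := dot_ge0 z.
have Ax : dot x (A *m x) = a ^+ 2 * l + dot z (A *m z).
  rewrite {1 2}xE mulmxDr -scalemxAr Av !dotE (dotC z v) vz v1.
  by rewrite (dot_tr A v) symA Av dotZl vz /l; ring.
have xi k : x k 0 = a * v k 0 + z k 0 by rewrite {1}xE !mxE.
rewrite dot_edge_mx !xi Ax.
have := gap _ vz.
set g := l - s - 1; have g0 : 0 < g by rewrite /g; lra.
set vi := v i 0; set vj := v j 0; set zi := z i 0; set zj := z j 0.
(* The arithmetic-geometric mean inequality absorbs the cross terms in the
   gap. *)
have AG (b c : R) : 2 * a * b * c <= g * b ^+ 2 + c ^+ 2 / g.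
  have a1 : a ^+ 2 <= 1 by lra.
  have H : 2 * a * b * c <= g * b ^+ 2 + a ^+ 2 * (c ^+ 2 / g).
    rewrite -subr_ge0.
    have -> : g * b ^+ 2 + a ^+ 2 * (c ^+ 2 / g) - 2 * a * b * c =
       g^-1 * (g * b - a * c) ^+ 2.
      by field; rewrite gt_eqF.
    by rewrite mulr_ge0 ?invr_ge0 ?sqr_ge0 ?ltW.
  apply: le_trans H _; rewrite lerD2l ler_piMl //.
  by rewrite divr_ge0 ?sqr_ge0 ?ltW.
have H1 := AG zi vj; have H2 := AG zj vi.
have a2v : a ^+ 2 * (2 * vi * vj) <= 2 * vi * vj.
  rewrite ler_piMl //; last by lra.
  by rewrite !mulr_ge0 // /vi /vj.
have zz2 : 2 * zi * zj <= zi ^+ 2 + zj ^+ 2.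
  by have := sqr_ge0 (zi - zj); lra.
have zij : zi ^+ 2 + zj ^+ 2 <= dot z z by exact: dot_ge_two.
have gz : g * (zi ^+ 2 + zj ^+ 2) <= g * dot z z by rewrite ler_wpM2l // ltW.
have gE : g * dot z z = l * dot z z - s * dot z z - dot z z by rewrite /g; ring.
have lz : a ^+ 2 * l + l * dot z z = l by rewrite [_ * l]mulrC -mulrDr az mulr1.
have -> : (vi ^+ 2 + vj ^+ 2) / g = vi ^+ 2 / g + vj ^+ 2 / g by rewrite mulrDl.
move: (vi ^+ 2 / g) (vj ^+ 2 / g) H1 H2 => p1 p2 H1 H2 gapz.
lra.
Qed.

End TopVector.

(** * Leaving out one vertex *)

Section LeaveOneOut.
Variable R : realType.

(** The matrix [A] with the row and the column [i] replaced by zero. *)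
Definition leave_out n (A : 'M[R]_n) (i : 'I_n) : 'M[R]_n :=
  \matrix_(j, k) if (j == i) || (k == i) then 0 else A j k.

Lemma ler_of_sqr (a b : R) : 0 <= b -> a ^+ 2 <= b ^+ 2 -> a <= b.
Proof.
move=> b0 ab; apply: le_trans (ler_norm a) _.
by rewrite -ler_sqr ?nnegrE // real_normK ?num_real.
Qed.

Lemma dot_leave_out n (x y : 'cV[R]_n) (A : 'M[R]_n) i : y i 0 = 0 -> x i 0 = 0 ->
  dot x (leave_out A i *m y) = dot x (A *m y).
Proof.
move=> y0 x0; rewrite !dot_mulmx; apply: eq_bigr => j _; apply: eq_bigr => k _.
rewrite mxE; have [->|_] := eqVneq j i; first by rewrite x0 !mul0r.
by have [->|_] := eqVneq k i; first by rewrite y0 !mulr0.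
Qed.

(** Comparison of the top eigenvector [v] of a graph with the top eigenvector
[w] of the graph without the edges at [i], under a spectral gap of order [d]
and a bound [D] on the degree of [i].  The first conclusion bounds [v i] by the
neighbours of [i] in the other eigenvector, the second one says that [w] is no
more localized than [v]. *)
Lemma leave_one_out n (A : 'M[R]_n) i v w s d D :
  (0 < n)%N -> A^T = A -> (forall j k, A j k = 0 \/ A j k = 1) -> A i i = 0 ->
  top_vector_of A v -> top_vector_of (leave_out A i) w ->
  0 < d -> 0 <= s -> s <= d / 16 -> 3 / 4 * d <= opnorm A ->
  \sum_j A i j <= D -> D <= d ^+ 2 / 64 ->
  (forall y, dot (ones R n) y = 0 -> dot y (A *m y) <= s * dot y y) ->
  v i 0 ^+ 4 <= 16 * D ^+ 2 / d ^+ 4 * (\sum_j A i j * w j 0 ^+ 2) ^+ 2 /\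
  \sum_j w j 0 ^+ 4 <= 32 * \sum_j v j 0 ^+ 4.
Proof.
move=> n0 symA A01 Aii tv tw d0 s0 sd ld degD Dd gap.
set l := opnorm A in ld *; set mu := opnorm (leave_out A i).
have [v0 v1 Av] := tv; have [w0 w1 Aw] := tw.
have A0 j k : 0 <= A j k by case: (A01 j k) => ->.
have Asq j k : A j k ^+ 2 = A j k by case: (A01 j k) => ->; rewrite ?expr0n ?expr1n.
have symAE j k : A j k = A k j by rewrite -[in RHS]symA mxE.
pose a : 'cV[R]_n := \col_j A i j.
have aa : dot a a <= D.
  apply: le_trans degD; rewrite le_eqVlt; apply/orP; left; apply/eqP.
  by apply: eq_bigr => j _; rewrite mxE -expr2 Asq.
have D0 : 0 <= D by apply: le_trans aa; exact: dot_ge0.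
set vi := v i 0; have vi0 : 0 <= vi by exact: v0.
have avE : dot a v = l * vi.
  have := congr1 (fun M : 'cV_n => M i 0) Av; rewrite /l /vi !mxE => <-.
  by apply: eq_bigr => j _; rewrite mxE.
have lp : 0 < l by lra.
have vi2 : vi ^+ 2 <= 1 / 36.
  have H : l ^+ 2 * vi ^+ 2 <= D.
    rewrite -exprMn -avE; apply: le_trans (cauchy_schwarz _ _) _.
    by rewrite v1 mulr1.
  have l2 : (3 / 4 * d) ^+ 2 <= l ^+ 2 by rewrite ler_sqr ?nnegrE; lra.
  have : (3 / 4 * d) ^+ 2 * vi ^+ 2 <= l ^+ 2 * vi ^+ 2.
    by rewrite ler_wpM2r ?sqr_ge0.
  have dp : 0 < d ^+ 2 by rewrite exprn_gt0.
  have -> : (3 / 4 * d) ^+ 2 * vi ^+ 2 = d ^+ 2 * (9 / 16 * vi ^+ 2) by field.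
  move=> H1; have : d ^+ 2 * (9 / 16 * vi ^+ 2) <= d ^+ 2 * (1 / 64) by lra.
  by rewrite ler_pM2l //; lra.
pose u : 'cV[R]_n := \col_j if j == i then 0 else v j 0.
have ui : u i 0 = 0 by rewrite mxE eqxx.
have u0 j : 0 <= u j 0 by rewrite mxE; case: ifP.
have uu : dot u u = 1 - vi ^+ 2.
  rewrite -v1 /dot (bigD1 i) //= [in RHS](bigD1 i) //= ui mul0r -/vi.
  rewrite (eq_bigr (fun j => v j 0 * v j 0)) => [|j /negbTE ne].
    by rewrite expr2; ring.
  by rewrite mxE ne.
have au : dot a u = l * vi.
  rewrite -avE; apply: eq_bigr => j _; rewrite !mxE.
  by case: eqP => [->|//]; rewrite Aii !mul0r.
have Au : leave_out A i *m u = l *: u - vi *: a.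
  apply/matrixP=> j k; rewrite ord1 !mxE.
  have [->|ne] := eqVneq j i.
    by rewrite Aii big1 ?mulr0 ?subr0 // => m _; rewrite mxE eqxx mul0r.
  have := congr1 (fun M : 'cV_n => M j 0) Av; rewrite !mxE -/l => <-.
  rewrite (bigD1 i) //= [in RHS](bigD1 i) //= !mxE eqxx mulr0 add0r -/vi.
  rewrite (symAE i j) (mulrC vi) addrAC subrr add0r; apply: eq_bigr => m /negbTE nm.
  by rewrite !mxE (negbTE ne) nm.
(* The vector [u], which is [v] without its coordinate [i], is a test
   vector for the norm of the reduced matrix. *)
have muE : mu * dot u u >= l * (1 - 2 * vi ^+ 2).
  have := dot_opnorm (leave_out A i) u; rewrite Au !dotE (dotC u a) au uu -/mu.
  lra.
have mup : d / 2 <= mu.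
  have h : mu * dot u u <= mu.
    by rewrite uu ler_piMr ?opnorm_ge0 // lerBlDr lerDl sqr_ge0.
  have : 3 / 4 * d * (17 / 18) <= l * (1 - 2 * vi ^+ 2).
    by apply: ler_pM => //; lra.
  lra.
have wi : w i 0 = 0.
  have := congr1 (fun M : 'cV_n => M i 0) Aw; rewrite !mxE big1 => [|j _].
    by move=> /esym/eqP; rewrite mulf_eq0 -/mu gt_eqF /=; [move/eqP|lra].
  by rewrite mxE eqxx mul0r.
pose c := dot w u.
have [z zE] : exists z, z = u - c *: w by exists (u - c *: w).
have uE : u = c *: w + z by rewrite zE addrC subrK.
have wz : dot w z = 0 by rewrite zE !dotE w1 /c; ring.
have zi : z i 0 = 0 by rewrite zE !mxE eqxx wi; ring.
have symL : (leave_out A i)^T = leave_out A i.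
  by apply/matrixP=> j k; rewrite !mxE orbC symAE.
have zgap : dot z (leave_out A i *m z) <= s * dot z z.
  apply: (@spectral_gap R n _ mu w) => //; first by lra.
    exact: (top_vector_sum_gt0 tw).
  move=> p q y y1; rewrite dot_leave_out ?gap //.
    by rewrite !mxE wi zi; ring.
  by rewrite !mxE wi zi; ring.
have zz0 := dot_ge0 z.
have zu : dot z u = dot z z by rewrite {1}uE !dotE (dotC z w) wz; ring.
have zAu : dot z (leave_out A i *m u) = dot z (leave_out A i *m z).
  by rewrite {1}uE mulmxDr -scalemxAr Aw !dotE (dotC z w) wz; ring.
(* The component [z] of [u] orthogonal to [w] is of order [vi]: it is
   the solution of an eigenvalue equation with right-hand side [- vi a]. *)
have key : (l - s) * dot z z <= vi * dot a z.
  move: zAu; rewrite Au !dotE zu (dotC z a) => zAu.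
  lra.
have az2 : dot a z ^+ 2 <= D * dot z z.
  apply: le_trans (cauchy_schwarz _ _) _; rewrite ler_wpM2r //.
have ls : d / 2 <= l - s by lra.
have dp : 0 < d ^+ 2 by rewrite exprn_gt0.
have zz : dot z z <= 4 * vi ^+ 2 * D / d ^+ 2.
  rewrite ler_pdivlMr //.
  have [->|zn0] := eqVneq (dot z z) 0.
    by rewrite mul0r !mulr_ge0 ?sqr_ge0.
  have zp : 0 < dot z z by rewrite lt_def zn0.
  have h1 : (d / 2 * dot z z) ^+ 2 <= (vi * dot a z) ^+ 2.
    have h2 : d / 2 * dot z z <= (l - s) * dot z z by rewrite ler_wpM2r.
    have h3 : 0 <= d / 2 * dot z z by rewrite mulr_ge0 //; lra.
    by rewrite ler_sqr ?nnegrE //; lra.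
  have h2 : (vi * dot a z) ^+ 2 <= vi ^+ 2 * (D * dot z z).
    by rewrite exprMn ler_wpM2l ?sqr_ge0.
  have : dot z z * (dot z z * d ^+ 2) <= dot z z * (4 * vi ^+ 2 * D) by lra.
  by rewrite ler_pM2l.
have Dd2 : D / d ^+ 2 <= 1 / 64 by rewrite ler_pdivrMr //; lra.
have zz' : dot z z <= vi ^+ 2 / 16.
  apply: le_trans zz _.
  have -> : 4 * vi ^+ 2 * D / d ^+ 2 = 4 * vi ^+ 2 * (D / d ^+ 2) by field; rewrite gt_eqF.
  have : 4 * vi ^+ 2 * (D / d ^+ 2) <= 4 * vi ^+ 2 * (1 / 64).
    by rewrite ler_wpM2l // mulr_ge0 // sqr_ge0.
  lra.
have c0 : 0 <= c by apply: sumr_ge0 => j _; rewrite mulr_ge0.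
have cE : c ^+ 2 = dot u u - dot z z.
  have -> : dot u u = dot (c *: w + z) (c *: w + z) by rewrite -uE.
  by rewrite !dotE w1 (dotC z w) wz; ring.
have vi4 : 0 <= vi ^+ 2 by rewrite sqr_ge0.
have c1 : c <= 1 by apply: ler_of_sqr => //; rewrite cE uu expr1n; lra.
pose t := \sum_j A i j * w j 0 ^+ 2.
have aw0 : 0 <= dot a w by apply: sumr_ge0 => j _; rewrite mulr_ge0 // mxE.
have aw2 : dot a w ^+ 2 <= D * t.
  pose b : 'cV[R]_n := \col_j (A i j * w j 0).
  have -> : dot a w = dot a b.
    by apply: eq_bigr => j _; rewrite !mxE mulrA -expr2 Asq.
  have -> : t = dot b b.
    by apply: eq_bigr => j _; rewrite !mxE -expr2 exprMn Asq.
  by apply: le_trans (cauchy_schwarz _ _) _; rewrite ler_wpM2r ?dot_ge0.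
have az : dot a z <= vi * d / 32.
  apply: ler_of_sqr; first by rewrite !mulr_ge0 // ltW.
  apply: le_trans az2 _.
  have h1 : D * dot z z <= d ^+ 2 / 64 * (vi ^+ 2 / 16) by apply: ler_pM.
  have -> : (vi * d / 32) ^+ 2 = d ^+ 2 / 64 * (vi ^+ 2 / 16) by field.
  exact: h1.
have viaw : d / 2 * vi <= dot a w.
  have auE : dot a u = c * dot a w + dot a z.
    by rewrite {1}uE !dotE.
  have : c * dot a w <= dot a w by rewrite ler_piMl.
  have : 3 / 4 * d * vi <= l * vi by rewrite ler_wpM2r.
  have : 0 <= d * vi by rewrite mulr_ge0 // ltW.
  lra.
have t0 : 0 <= t by apply: sumr_ge0 => j _; rewrite mulr_ge0 // sqr_ge0.
split.
  rewrite -/t.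
  have h1 : (d / 2 * vi) ^+ 2 <= D * t.
    apply: le_trans aw2; rewrite ler_sqr ?nnegrE // !mulr_ge0 //; lra.
  have h2 : vi ^+ 2 <= 4 * D / d ^+ 2 * t.
    rewrite mulrAC ler_pdivlMr //; lra.
  have -> : 16 * D ^+ 2 / d ^+ 4 * t ^+ 2 = (4 * D / d ^+ 2 * t) ^+ 2.
    by field; rewrite gt_eqF.
  have -> : vi ^+ 4 = (vi ^+ 2) ^+ 2 by rewrite -exprM.
  by rewrite ler_sqr ?nnegrE //; apply: le_trans h2.
have c4 : 1 <= 4 * c ^+ 4.
  have h1 : 1 / 2 <= c ^+ 2 by rewrite cE uu; lra.
  have : (1 / 2) ^+ 2 <= (c ^+ 2) ^+ 2 by rewrite ler_sqr ?nnegrE; lra.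
  by rewrite -exprM; lra.
have pw j : c ^+ 4 * w j 0 ^+ 4 <= 8 * u j 0 ^+ 4 + 8 * z j 0 ^+ 4.
  have -> : c ^+ 4 * w j 0 ^+ 4 = (u j 0 - z j 0) ^+ 4.
    by rewrite -exprMn uE !mxE; congr (_ ^+ _); ring.
  move: (u j 0) (z j 0) => x y.
  have h1 : (x - y) ^+ 2 <= 2 * (x ^+ 2 + y ^+ 2).
    by have := sqr_ge0 (x + y); lra.
  have h2 : ((x - y) ^+ 2) ^+ 2 <= (2 * (x ^+ 2 + y ^+ 2)) ^+ 2.
    by rewrite ler_sqr ?nnegrE ?sqr_ge0 // mulr_ge0 // addr_ge0 ?sqr_ge0.
  have h3 := sqr_ge0 (x ^+ 2 - y ^+ 2).
  rewrite -exprM in h2.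
  lra.
have W0 : 0 <= \sum_j w j 0 ^+ 4.
  by apply: sumr_ge0 => j _; rewrite exprn_even_ge0.
have h1 : c ^+ 4 * \sum_j w j 0 ^+ 4 <=
    8 * \sum_j u j 0 ^+ 4 + 8 * \sum_j z j 0 ^+ 4.
  by rewrite !mulr_sumr -big_split; apply: ler_sum => j _; exact: pw.
have h2 : \sum_j z j 0 ^+ 4 <= vi ^+ 4.
  have : \sum_j z j 0 ^+ 4 <= dot z z ^+ 2.
    rewrite expr2 {1}/dot mulr_suml; apply: ler_sum => j _.
    have -> : z j 0 ^+ 4 = (z j 0 * z j 0) * (z j 0 ^+ 2) by ring.
    rewrite ler_wpM2l -?expr2 ?sqr_ge0 // /dot (bigD1 j) //= -expr2 lerDl.
    by apply: sumr_ge0 => k _; rewrite -expr2 sqr_ge0.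
  have : dot z z ^+ 2 <= (vi ^+ 2) ^+ 2.
    by rewrite ler_sqr ?nnegrE //; lra.
  by rewrite -exprM; lra.
have h3 : \sum_j v j 0 ^+ 4 = vi ^+ 4 + \sum_j u j 0 ^+ 4.
  rewrite (bigD1 i) //= [in RHS](bigD1 i) //= ui expr0n add0r -/vi.
  by congr (_ + _); apply: eq_bigr => j /negbTE ne; rewrite mxE ne.
have : \sum_j w j 0 ^+ 4 <= 4 * c ^+ 4 * \sum_j w j 0 ^+ 4 by rewrite ler_peMl.
rewrite h3; lra.
Qed.

End LeaveOneOut.

(** * Closed walks and traces of powers *)

Section Walks.

(** The unordered pair of [i] and [j], represented by the ordered pair whose
first component is the smaller one. *)
Definition edge_key n (i j : 'I_n) : 'I_n * 'I_n :=
  if (i < j)%N then (i, j) else (j, i).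

Lemma edge_keyC n (i j : 'I_n) : edge_key i j = edge_key j i.
Proof. by rewrite /edge_key; case: ltngtP => // /ord_inj ->. Qed.

Lemma edge_key_lt n (i j : 'I_n) : i != j ->
  ((edge_key i j).1 < (edge_key i j).2)%N.
Proof. by rewrite -val_eqE /edge_key; case: ifP => /= *; lia. Qed.

Lemma edge_key_eq n (i j k l : 'I_n) :
  (edge_key i j == edge_key k l) =
  ((i == k) && (j == l)) || ((i == l) && (j == k)).
Proof.
rewrite /edge_key; case: ifP => ij; case: ifP => kl;
  rewrite xpair_eqE -!val_eqE /=; lia.
Qed.

Variables (n : nat).

(** A walk of length [l] is a map from its [l.+1] times to the vertices; its
step [t] goes from the vertex at time [t] to the vertex at time [t.+1]. *)
Definition wsrc l (u : {ffun 'I_l.+1 -> 'I_n}) (t : 'I_l) : 'I_n :=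
  u (widen_ord (leqnSn l) t).
Definition wtgt l (u : {ffun 'I_l.+1 -> 'I_n}) (t : 'I_l) : 'I_n :=
  u (lift ord0 t).
Definition wkey l (u : {ffun 'I_l.+1 -> 'I_n}) (t : 'I_l) :=
  edge_key (wsrc u t) (wtgt u t).

Definition walk_cons l x (u : {ffun 'I_l.+1 -> 'I_n}) :
    {ffun 'I_l.+2 -> 'I_n} :=
  [ffun t => if unlift ord0 t is Some t' then u t' else x].
Definition walk_tail l (u : {ffun 'I_l.+2 -> 'I_n}) : {ffun 'I_l.+1 -> 'I_n} :=
  [ffun t => u (lift ord0 t)].

Lemma walk_cons0 l x (u : {ffun 'I_l.+1 -> 'I_n}) : walk_cons x u ord0 = x.
Proof. by rewrite ffunE unlift_none. Qed.

Lemma walk_consS l x (u : {ffun 'I_l.+1 -> 'I_n}) t :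
  walk_cons x u (lift ord0 t) = u t.
Proof. by rewrite ffunE liftK. Qed.

Lemma walk_consK l x : cancel (@walk_cons l x) (@walk_tail l).
Proof. by move=> u; apply/ffunP=> t; rewrite !ffunE liftK. Qed.

Lemma walk_tailK l (u : {ffun 'I_l.+2 -> 'I_n}) :
  walk_cons (u ord0) (walk_tail u) = u.
Proof.
apply/ffunP=> t; case: (unliftP ord0 t) => [t' ->|->].
  by rewrite walk_consS ffunE.
by rewrite walk_cons0.
Qed.

Lemma mx_pow_walk (R : comNzRingType) l (M : 'M[R]_n) i j :
  (M ^+ l) i j = \sum_(u : {ffun 'I_l.+1 -> 'I_n} |
      (u ord0 == i) && (u ord_max == j)) \prod_t M (wsrc u t) (wtgt u t).
Proof.
elim: l i => [|l IH] i.
  rewrite expr0 /= mxE.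
  have zz : ord_max = ord0 :> 'I_1 by apply/val_inj.
  rewrite (eq_bigl (fun u => (i == j) && (u == [ffun=> i]))) => [|u].
    case: (i == j); last by rewrite big_pred0.
    by rewrite /= big_pred1_eq big_ord0.
  rewrite zz; have -> : (u == [ffun=> i]) = (u ord0 == i).
    apply/eqP/eqP => [->|ui]; first by rewrite ffunE.
    by apply/ffunP=> t; rewrite ffunE ord1.
  by case: (u ord0 =P i) => [->|]; rewrite ?andbT ?andbF.
rewrite exprS mxE.
under eq_bigr => k _ do rewrite IH big_distrr /=.
rewrite (exchange_big_dep (fun u : {ffun 'I_l.+1 -> 'I_n} => u ord_max == j)) /=;
  last by move=> k u _ /andP[].
rewrite [RHS](reindex_onto (walk_cons i) (@walk_tail l)) /=; last first.
  by move=> u /andP[/eqP <- _]; rewrite walk_tailK.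
apply: eq_big => [u|u uj].
  rewrite walk_consK eqxx andbT walk_cons0 eqxx /=.
  have -> : ord_max = lift ord0 ord_max :> 'I_l.+2 by apply/val_inj.
  by rewrite walk_consS.
rewrite (big_pred1 (u ord0)) => [|k]; last by rewrite uj andbT eq_sym.
rewrite [RHS]big_ord_recl; congr (_ * _).
  rewrite /wsrc /wtgt walk_consS; congr (M _ _).
  have -> : widen_ord (leqnSn l.+1) ord0 = ord0 by apply/val_inj.
  by rewrite walk_cons0.
apply: eq_bigr => t _; rewrite /wsrc /wtgt walk_consS.
have -> : widen_ord (leqnSn l.+1) (lift ord0 t) =
   lift ord0 (widen_ord (leqnSn l) t) by apply/val_inj.
by rewrite walk_consS.
Qed.

Lemma trace_pow_walk (R : comNzRingType) l (M : 'M[R]_n) :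
  \tr (M ^+ l) = \sum_(u : {ffun 'I_l.+1 -> 'I_n} | u ord0 == u ord_max)
      \prod_t M (wsrc u t) (wtgt u t).
Proof.
rewrite /mxtrace; under eq_bigr => i _ do rewrite mx_pow_walk.
rewrite (exchange_big_dep (fun u : {ffun 'I_l.+1 -> 'I_n} =>
  u ord0 == u ord_max)) /=; last by move=> i u _ /andP[/eqP-> /eqP->].
apply: eq_bigr => u u0; rewrite (big_pred1 (u ord0)) // => i.
by rewrite -(eqP u0) /= eq_sym andbb.
Qed.

Definition walk_verts l (u : {ffun 'I_l.+1 -> 'I_n}) : {set 'I_n} :=
  u @: [set: 'I_l.+1].
Definition walk_keys l (u : {ffun 'I_l.+1 -> 'I_n}) : {set 'I_n * 'I_n} :=
  wkey u @: [set: 'I_l].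

(** A walk visits at most one vertex more than it uses edges: each new vertex
is entered through a new edge.  The induction removes the first step. *)
Lemma walk_verts_keys l (u : {ffun 'I_l.+1 -> 'I_n}) :
  (#|walk_verts u| <= #|walk_keys u|.+1)%N.
Proof.
elim: l u => [|l IH] u.
  apply: leq_trans (leq_imset_card _ _) _.
  by rewrite cardsT card_ord.
have vE : walk_verts u = u ord0 |: walk_verts (walk_tail u).
  apply/setP=> x; apply/imsetP/setU1P => [[t _ ->]|[->|/imsetP[t _ ->]]].
  - case: (unliftP ord0 t) => [t' ->|->]; [right|by left].
    by apply/imsetP; exists t'; rewrite ?ffunE.
  - by exists ord0.
  - by exists (lift ord0 t); rewrite // ffunE.
have keyS t : wkey u (lift ord0 t) = wkey (walk_tail u) t.
  rewrite /wkey /wsrc /wtgt !ffunE; congr (edge_key (u _) _).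
  exact/val_inj.
have kE : walk_keys u = wkey u ord0 |: walk_keys (walk_tail u).
  apply/setP=> x; apply/imsetP/setU1P => [[t _ ->]|[->|/imsetP[t _ ->]]].
  - case: (unliftP ord0 t) => [t' ->|->]; [right|by left].
    by apply/imsetP; exists t'.
  - by exists ord0.
  - by exists (lift ord0 t).
have {}IH := IH (walk_tail u).
rewrite vE kE !cardsU1.
case: (boolP (u ord0 \in _)) => [_|u0].
  by apply: leq_trans IH _; rewrite ltnS leq_addl.
suff -> : wkey u ord0 \notin walk_keys (walk_tail u) by [].
apply: contra u0 => /imsetP[t _] /eqP.
rewrite edge_key_eq; have -> : wsrc u ord0 = u ord0.
  by congr (u _); exact/val_inj.
by case/orP => /andP[/eqP -> _]; rewrite /wsrc /wtgt imset_f.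
Qed.

(** Closed walks without loops that use each of their edges at least twice. *)
Definition good_walk l (u : {ffun 'I_l.+1 -> 'I_n}) : bool :=
  [&& u ord0 == u ord_max, [forall t, wsrc u t != wtgt u t] &
    [forall t, exists s, (s != t) && (wkey u s == wkey u t)]].

End Walks.

(** Two maps identify the same pairs of arguments. *)
Definition same_kernel (T X Y : finType) (u : {ffun T -> X}) (u' : {ffun T -> Y}) :=
  [forall s, forall t, (u s == u t) == (u' s == u' t)].

Lemma same_kernelP (T X Y : finType) (u : {ffun T -> X}) (u' : {ffun T -> Y}) :
  reflect (forall s t, (u s == u t) = (u' s == u' t)) (same_kernel u u').
Proof.
apply: (iffP forallP) => [H s t|H s]; first by have /forallP/(_ t)/eqP := H s.
by apply/forallP => t; rewrite H.
Qed.

Lemma same_kernelC (T X Y : finType) (u : {ffun T -> X}) (u' : {ffun T -> Y}) :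
  same_kernel u u' = same_kernel u' u.
Proof. by apply/same_kernelP/same_kernelP => H s t; rewrite H. Qed.

Lemma good_walk_kernel n m l (u : {ffun 'I_l.+1 -> 'I_n})
    (u' : {ffun 'I_l.+1 -> 'I_m}) :
  same_kernel u u' -> good_walk u = good_walk u'.
Proof.
move=> /same_kernelP uu'; rewrite /good_walk uu'; congr [&& _, _ & _].
  by apply: eq_forallb => t; rewrite /wsrc /wtgt uu'.
apply: eq_forallb => t; apply: eq_existsb => s; congr (_ && _).
by rewrite /wkey !edge_key_eq /wsrc /wtgt !uu'.
Qed.

(** Maps with the same coincidences as [u] correspond to injections of the
image of [u]. *)
Lemma card_same_kernel (T X Y : finType) (u : {ffun T -> X}) :
  #|[set u' : {ffun T -> Y} | same_kernel u u']| = (#|Y| ^_ #|u @: [set: T]|)%N.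
Proof.
pose K := {x : X | x \in u @: [set: T]}.
have uK t : u t \in u @: [set: T] by apply: imset_f.
pose c (t : T) : K := Sub (u t) (uK t).
have cK (k : K) : exists t, c t == k.
  by case: k => x xP; have /imsetP[t _ xE] := xP; exists t; apply/eqP/val_inj.
pose h (f : {ffun K -> Y}) : {ffun T -> Y} := [ffun t => f (c t)].
have <- : #|{: K}| = #|u @: [set: T]| by rewrite card_sig; apply: eq_card.
rewrite -card_inj_ffuns -(@card_imset _ _ h); last first.
  move=> f g /ffunP fg; apply/ffunP => k; have [t /eqP <-] := cK k.
  by have := fg t; rewrite !ffunE.
apply: eq_card => u'; rewrite inE; apply/same_kernelP/imsetP.
  move=> uu'; pose f : {ffun K -> Y} := [ffun k => u' (xchoose (cK k))].
  have fc t : f (c t) = u' t.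
    rewrite ffunE; apply/eqP; rewrite -uu'.
    by have /eqP/(congr1 val)/= -> := xchooseP (cK (c t)).
  exists f; last by apply/ffunP=> t; rewrite ffunE fc.
  rewrite inE; apply/injectiveP => k k'; have [t /eqP <-] := cK k; have [s /eqP <-] := cK k'.
  by rewrite !fc => /eqP; rewrite -uu' => /eqP ts; apply/val_inj.
case=> f; rewrite inE => /injectiveP finj -> s t; rewrite !ffunE.
by rewrite (inj_eq finj).
Qed.

Lemma leq_verts_kernel n m l (u : {ffun 'I_l.+1 -> 'I_n})
    (u' : {ffun 'I_l.+1 -> 'I_m}) :
  same_kernel u u' -> (#|walk_verts u'| <= #|walk_verts u|)%N.
Proof.
move=> /same_kernelP uu'.
pose h x := if [pick t | u t == x] is Some t then u' t else u' ord0.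
have hu t : h (u t) = u' t.
  rewrite /h; case: pickP => [s|/(_ t)]; last by rewrite eqxx.
  by rewrite uu' => /eqP.
rewrite (_ : walk_verts u' = h @: walk_verts u) ?leq_imset_card //.
by rewrite /walk_verts -imset_comp; apply: eq_imset => t; rewrite /= hu.
Qed.

Lemma card_verts_kernel n m l (u : {ffun 'I_l.+1 -> 'I_n})
    (u' : {ffun 'I_l.+1 -> 'I_m}) :
  same_kernel u u' -> #|walk_verts u| = #|walk_verts u'|.
Proof.
move=> uu'; apply/eqP; rewrite eqn_leq !leq_verts_kernel //.
by rewrite same_kernelC.
Qed.

Section Compare.
Variable R : realFieldType.

(** Grouping good walks by their pattern of coincidences.  A pattern with [m]
vertices has at most [n ^ m] realizations on [n] points, and at least
[r (n p) ^ (m - 1)] on [r] points, whence the factor [n / r]. *)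
Lemma walk_compare n r l (p : R) : 0 <= p -> l%:R + n%:R * p <= r%:R ->
  (0 < n)%N -> (0 < r)%N -> (l < r)%N ->
  \sum_(u : {ffun 'I_l.+1 -> 'I_n} | good_walk u) p ^+ #|walk_verts u|.-1 <=
  n%:R / r%:R * #|[set u : {ffun 'I_l.+1 -> 'I_r} | good_walk u]|%:R.
Proof.
move=> p0 lnp n0 r0 lr.
have vpos (m : nat) (u : {ffun 'I_l.+1 -> 'I_m}) : (0 < #|walk_verts u|)%N.
  by apply/card_gt0P; exists (u ord0); apply: imset_f.
have vle (m : nat) (u : {ffun 'I_l.+1 -> 'I_m}) : (#|walk_verts u| <= l.+1)%N.
  by apply: leq_trans (leq_imset_card _ _) _; rewrite cardsT card_ord.
have np0 : 0 <= n%:R * p by rewrite mulr_ge0.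
(* Each of the [m] factors [r - 1 - i] is at least [r - l >= n p]. *)
have ffr m : (m <= l)%N ->
    (n%:R * p) ^+ m <= ((r.-1 ^_ m)%N)%:R /\ (0 < r.-1 ^_ m)%N.
  move=> ml; split; last by rewrite ffact_gt0; lia.
  rewrite ffact_prod natr_prod -[m in X in X <= _]card_ord -prodr_const.
  apply: ler_prod => i _; rewrite np0 /=.
  have -> : (r.-1 - i)%N = (r - i.+1)%N by lia.
  rewrite natrB; last by have := ltn_ord i; lia.
  have : (i.+1)%:R <= l%:R :> R by rewrite ler_nat; have := ltn_ord i; lia.
  lra.
have key m : (0 < m)%N -> (m <= l.+1)%N ->
    p ^+ m.-1 / ((r ^_ m)%N)%:R * ((n ^_ m)%N)%:R <= n%:R / r%:R :> R.
  case: m => // m _ ml /=; have [h1 h2] := ffr m ml.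
  rewrite !ffactnS !natrM.
  have h3 : ((n.-1 ^_ m)%N)%:R <= n%:R ^+ m :> R.
    rewrite ffact_prod natr_prod -[m in X in _ <= X]card_ord -prodr_const.
    by apply: ler_prod => i _; rewrite ler0n ler_nat; lia.
  have rp : 0 < r%:R :> R by rewrite ltr0n.
  have fp : 0 < ((r.-1 ^_ m)%N)%:R :> R by rewrite ltr0n.
  have -> : p ^+ m / (r%:R * ((r.-1 ^_ m)%N)%:R) * (n%:R * ((n.-1 ^_ m)%N)%:R) =
     n%:R / r%:R * (p ^+ m * ((n.-1 ^_ m)%N)%:R / ((r.-1 ^_ m)%N)%:R) :> R.
    by field; rewrite !gt_eqF.
  rewrite ler_piMr ?divr_ge0 //= ler_pdivrMr // mul1r.
  apply: le_trans h1; rewrite mulrC exprMn ler_wpM2r ?exprn_ge0 //.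
pose F (m : nat) : R := p ^+ m.-1 / ((r ^_ m)%N)%:R.
have rne m : (m <= l.+1)%N -> ((r ^_ m)%N)%:R != 0 :> R.
  by move=> ml; rewrite pnatr_eq0 -lt0n ffact_gt0; lia.
have -> : \sum_(u : {ffun 'I_l.+1 -> 'I_n} | good_walk u) p ^+ #|walk_verts u|.-1 =
   \sum_(u : {ffun 'I_l.+1 -> 'I_n} | good_walk u)
     \sum_(u' : {ffun 'I_l.+1 -> 'I_r} | same_kernel u u') F #|walk_verts u'|.
  apply: eq_bigr => u _.
  rewrite (eq_bigr (fun=> F #|walk_verts u|)) => [|u' uu']; last first.
    by rewrite (card_verts_kernel uu').
  rewrite sumr_const [X in _ *+ X](_ : _ = (r ^_ #|walk_verts u|)%N); last first.
    by have := card_same_kernel 'I_r u; rewrite card_ord cardsE => <-; apply: eq_card.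
  by rewrite -[RHS]mulr_natr /F mulfVK // rne.
rewrite (exchange_big_dep (fun u' : {ffun 'I_l.+1 -> 'I_r} => good_walk u')) /=;
  last by move=> u u' gu uu'; rewrite -(good_walk_kernel uu').
rewrite cardsE -sum1_card natr_sum mulr_sumr; apply: ler_sum => u' gu'.
rewrite (eq_bigl (fun u : {ffun 'I_l.+1 -> 'I_n} => same_kernel u' u)); last first.
  move=> u; rewrite same_kernelC andbC; case: (boolP (same_kernel u' u)) => //= uu'.
  by rewrite -(good_walk_kernel uu') gu'.
rewrite sumr_const [X in _ *+ X](_ : _ = (n ^_ #|walk_verts u'|)%N); last first.
  by have := card_same_kernel 'I_n u'; rewrite card_ord cardsE => <-; apply: eq_card.
by rewrite mulr1 -[leLHS]mulr_natr; apply: key.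
Qed.

End Compare.

(** * Moments of traces of centred symmetric matrices *)

Section TraceMoments.
Variable R : realFieldType.

(** The probability [p] on the pairs that are increasing, and [0] on the
others, which are not used as edges. *)
Definition edge_prob n (p : R) (e : 'I_n * 'I_n) : R :=
  if (e.1 < e.2)%N then p else 0.

(** The symmetric matrix with zero diagonal whose entries are the images under
[b] of the coordinates of [w]. *)
Definition sym_mx n (b : bool -> R) (w : {ffun 'I_n * 'I_n -> bool}) : 'M[R]_n :=
  \matrix_(i, j) if i == j then 0 else b (w (edge_key i j)).

Lemma edge_prob01 n p : 0 <= p <= 1 -> forall e, 0 <= @edge_prob n p e <= 1.
Proof. by move=> p01 e; rewrite /edge_prob; case: ifP => // _; rewrite lexx ler01. Qed.

(** The number of times the walk uses the edge [e]. *)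
Definition walk_mult n l (u : {ffun 'I_l.+1 -> 'I_n}) e : nat :=
  #|[pred t | wkey u t == e]|.

(** The moment of order [m] of [b x] for [x] a Bernoulli variable of
parameter [q]. *)
Definition bern_moment (q : R) (b : bool -> R) (m : nat) : R :=
  q * b true ^+ m + (1 - q) * b false ^+ m.

Lemma bern_mean_walk n l p b (u : {ffun 'I_l.+1 -> 'I_n}) :
  bern_mean (edge_prob p) (fun w => \prod_t sym_mx b w (wsrc u t) (wtgt u t)) =
  [forall t, wsrc u t != wtgt u t]%:R *
    \prod_e bern_moment (edge_prob p e) b (walk_mult u e).
Proof.
rewrite -(bern_mean_prod _ (fun e x => b x ^+ walk_mult u e)) -bern_meanZ.
apply: eq_bern_mean => w; case: (boolP [forall t, _]) => [/forallP noloop|].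
  rewrite mul1r (partition_big (wkey u) predT) //=; apply: eq_bigr => e _.
  rewrite (eq_bigr (fun=> b (w e))) ?prodr_const // => t /eqP <-.
  by rewrite mxE (negbTE (noloop t)).
rewrite negb_forall => /existsP[t]; rewrite negbK => tt.
by rewrite mul0r (bigD1 t) //= mxE tt mul0r.
Qed.

Lemma walk_mult_gt0 n l (u : {ffun 'I_l.+1 -> 'I_n}) e :
  (0 < walk_mult u e)%N = (e \in walk_keys u).
Proof.
apply/card_gt0P/imsetP => [[t]|[t _ ->]]; first by rewrite inE => /eqP <-; exists t.
by exists t; rewrite inE.
Qed.

Lemma walk_key_lt n l (u : {ffun 'I_l.+1 -> 'I_n}) e :
  [forall t, wsrc u t != wtgt u t] -> e \in walk_keys u -> (e.1 < e.2)%N.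
Proof. by move=> /forallP H /imsetP[t _ ->]; apply: edge_key_lt. Qed.

Lemma walk_mult1 n l (u : {ffun 'I_l.+1 -> 'I_n}) :
  ~~ [forall t, exists s, (s != t) && (wkey u s == wkey u t)] ->
  exists e, walk_mult u e = 1%N.
Proof.
rewrite negb_forall => /existsP[t]; rewrite negb_exists => /forallP H.
exists (wkey u t); rewrite /walk_mult -(card1 t); apply: eq_card => s.
rewrite !inE; have := H s; rewrite negb_and negbK.
by case: (s =P t) => [-> _|_ /= /negbTE]; rewrite ?eqxx.
Qed.

Lemma walk_mult_ge2 n l (u : {ffun 'I_l.+1 -> 'I_n}) e :
  [forall t, exists s, (s != t) && (wkey u s == wkey u t)] ->
  e \in walk_keys u -> (1 < walk_mult u e)%N.
Proof.
move=> /forallP H /imsetP[t _ ->]; have /existsP[s /andP[st su]] := H t.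
by apply/card_gt1P; exists s, t; split; rewrite ?inE.
Qed.

(** The centred Bernoulli variable. *)
Definition centered (p : R) (x : bool) : R := x%:R - p.
(** The variable equal to [2] with probability [1/3] and to [-1] otherwise has
mean zero and all its other moments at least [1].  It thus dominates, walk by
walk, a centred Bernoulli variable; a symmetric variable would not, as the odd
moments of a centred Bernoulli variable need not vanish. *)
Definition skewed (x : bool) : R := if x then 2 else -1.

Lemma centered_moment_le p m : 0 <= p <= 1 -> (1 < m)%N ->
  `|bern_moment p (centered p) m| <= p.
Proof.
move=> /andP[p0 p1]; case: m => [|[|m]] // _.
have -> : bern_moment p (centered p) m.+2 =
    p * (1 - p) ^+ m.+2 + (1 - p) * (- p) ^+ m.+2.
  by rewrite /bern_moment /centered sub0r.
apply: le_trans (ler_normD _ _) _; rewrite (normrM p ((1 - p) ^+ m.+2)) (normrM (1 - p) ((- p) ^+ m.+2)).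
rewrite !normrX normrN.
rewrite !ger0_norm ?subr_ge0 // !exprSr !mulrA.
have h1 : (1 - p) ^+ m.+1 <= 1 by rewrite exprn_ile1 ?subr_ge0 // gerBl.
have h2 : p ^+ m.+1 <= 1 by rewrite exprn_ile1.
rewrite !exprSr in h1 h2.
have pq0 : 0 <= p * (1 - p) by rewrite mulr_ge0 ?subr_ge0.
have : p * (1 - p) * ((1 - p) ^+ m * (1 - p)) <= p * (1 - p) by rewrite ler_piMr.
have : p * (1 - p) * (p ^+ m * p) <= p * p.
  have -> : p * (1 - p) * (p ^+ m * p) = p * p * ((1 - p) * p ^+ m) by ring.
  rewrite ler_piMr ?mulr_ge0 //.
  by rewrite mulr_ile1 ?subr_ge0 ?exprn_ge0 ?gerBl // exprn_ile1.
lra.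
Qed.

Lemma centered_walk_le n l p (u : {ffun 'I_l.+1 -> 'I_n}) : 0 <= p <= 1 ->
  u ord0 == u ord_max ->
  bern_mean (edge_prob p)
    (fun w => \prod_t sym_mx (centered p) w (wsrc u t) (wtgt u t)) <=
  if good_walk u then p ^+ #|walk_verts u|.-1 else 0.
Proof.
move=> p01 cl; rewrite bern_mean_walk /good_walk cl /=.
have /andP[p0 p1] := p01.
case: (boolP [forall t, wsrc u t != wtgt u t]) => nl; last by rewrite mul0r.
rewrite mul1r.
case: (boolP [forall t, _]) => [tw|/walk_mult1[e e1]]; last first.
  rewrite (bigD1 e) //= e1 /edge_prob.
  rewrite (walk_key_lt nl) -?walk_mult_gt0 ?e1 //.
  rewrite (_ : bern_moment p _ 1 = 0) ?mul0r //.
  by rewrite /bern_moment /centered !expr1 /=; ring.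
apply: (@le_trans _ _ (\prod_(e in walk_keys u) p)).
  apply: le_trans (ler_norm _) _; rewrite normr_prod [leRHS]big_mkcond /=.
  apply: ler_prod => e _; rewrite normr_ge0 /=; case: ifP => ek.
    by rewrite /edge_prob (walk_key_lt nl ek) centered_moment_le ?walk_mult_ge2.
  move/negbT: ek; rewrite -walk_mult_gt0 lt0n negbK => /eqP ->.
  by rewrite /bern_moment !expr0 !mulr1 addrC subrK normr1.
rewrite prodr_const; apply: ler_wiXn2l => //.
by rewrite -subn1 leq_subLR add1n walk_verts_keys.
Qed.

Lemma skewed_moment m : bern_moment 3^-1 skewed m = (2 ^+ m + 2 * (-1) ^+ m) / 3.
Proof. by rewrite /bern_moment /skewed; field. Qed.

Lemma skewed_moment_ge1 m : m != 1%N -> 1 <= bern_moment 3^-1 skewed m.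
Proof.
rewrite skewed_moment; case: m => [|[|m]] // _; first by rewrite !expr0; lra.
have h : -1 <= (-1) ^+ m :> R.
  by have := lerNnormlW (_ : `|(-1) ^+ m : R| <= 1); apply; rewrite normrX normrN1 expr1n.
have h' : (-1) ^+ m <= 1 :> R.
  by apply: le_trans (ler_norm _) _; rewrite normrX normrN1 expr1n.
case: m h h' => [|m] h h'; first by rewrite expr2 sqrrN expr1n; lra.
have h2 : 1 <= 2 ^+ m :> R by rewrite exprn_ege1 //; lra.
rewrite !(exprS _ m.+2) !(exprS _ m.+1) !(exprS 2 m).
lra.
Qed.

Lemma skewed_walk_ge n l (u : {ffun 'I_l.+1 -> 'I_n}) : u ord0 == u ord_max ->
  (good_walk u)%:R <= bern_mean (edge_prob 3^-1)
    (fun w => \prod_t sym_mx skewed w (wsrc u t) (wtgt u t)).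
Proof.
move=> cl; rewrite bern_mean_walk /good_walk cl andTb.
case: (boolP [forall t, wsrc u t != wtgt u t]) => nl; last by rewrite mul0r.
rewrite mul1r.
case: (boolP [forall t, _]) => [tw|/walk_mult1[e e1]]; last first.
  rewrite (bigD1 e) //= e1 /edge_prob.
  rewrite (walk_key_lt nl) -?walk_mult_gt0 ?e1 //.
  have z : bern_moment 3^-1 skewed 1 = 0.
    by rewrite skewed_moment !expr1; field.
  by rewrite z mul0r ?mulr0.
rewrite -[leLHS](_ : \prod_(e : 'I_n * 'I_n) 1 = _); last by rewrite big1.
apply: ler_prod => e _; rewrite ler01 /=.
case: (boolP (e \in walk_keys u)) => ek.
  rewrite /edge_prob (walk_key_lt nl ek) skewed_moment_ge1 //.
  by have := walk_mult_ge2 tw ek; case: (walk_mult _ _) => [|[]].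
move: ek; rewrite -walk_mult_gt0 lt0n negbK => /eqP ->.
by rewrite /bern_moment !expr0 !mulr1 addrC subrK.
Qed.

(** Comparison of the trace moments of a sparse centred matrix of size [n] and
of a dense skewed matrix of size [r]. *)
Lemma trace_centered_le n r l (p : R) : 0 <= p <= 1 ->
  l%:R + n%:R * p <= r%:R -> (0 < n)%N -> (0 < r)%N -> (l < r)%N ->
  bern_mean (@edge_prob n p) (fun w => \tr (sym_mx (centered p) w ^+ l)) <=
  n%:R / r%:R *
  bern_mean (@edge_prob r 3^-1) (fun w => \tr (sym_mx skewed w ^+ l)).
Proof.
move=> p01 lr n0 r0 llr; have /andP[p0 _] := p01.
under eq_bern_mean do rewrite trace_pow_walk.
rewrite bern_mean_sum.
under [X in _ <= _ * X]eq_bern_mean do rewrite trace_pow_walk.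
rewrite bern_mean_sum.
apply: (@le_trans _ _ (\sum_(u : {ffun 'I_l.+1 -> 'I_n} | good_walk u)
    p ^+ #|walk_verts u|.-1)).
  rewrite [leRHS]big_mkcond [leLHS]big_mkcond /=; apply: ler_sum => u _.
  case: ifP => [cl|ncl]; first exact: centered_walk_le.
  by rewrite /good_walk ncl.
apply: le_trans (walk_compare p0 lr n0 r0 llr) _.
rewrite ler_wpM2l ?divr_ge0 // cardsE -sum1_card natr_sum.
rewrite [leRHS]big_mkcond [leLHS]big_mkcond /=; apply: ler_sum => u _.
rewrite [X in if X then _ else _](_ : _ = good_walk u) //.
case: (boolP (u ord0 == u ord_max)) => [cl|ncl].
  by apply: le_trans (skewed_walk_ge cl); case: (good_walk u).
by rewrite /good_walk (negbTE ncl).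
Qed.

End TraceMoments.

(** * Exponential moments of a quadratic form with skewed entries *)

Section Net.
Variable R : realType.

(** The linear term is what makes the bound useful for centred variables. *)
Lemma expR_le_quadratic (x : R) : expR x <= x + expR (2 * x ^+ 2).
Proof.
have [x2|x2] := leP (1 / 2) x.
  have h : x <= 2 * x ^+ 2.
    have : 0 <= x * (x - 1 / 2) by rewrite mulr_ge0; lra.
    lra.
  have : expR x <= expR (2 * x ^+ 2) by rewrite ler_expR.
  lra.
apply: (@le_trans _ _ (x + (1 + 2 * x ^+ 2))); last first.
  by rewrite lerD2l expR_ge1Dx.
have h1 : 1 - x / 2 <= (expR (x / 2))^-1.
  by rewrite -expRN; have := expR_ge1Dx (- (x / 2)).
have p1 : 0 < 1 - x / 2 by lra.
have ep := expR_gt0 (x / 2).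
have h2 : (1 - x / 2) * expR (x / 2) <= 1.
  by rewrite -ler_pdivlMr // div1r.
have -> : expR x = expR (x / 2) ^+ 2.
  by rewrite -expRM_natl; congr expR; field.
have h3 : ((1 - x / 2) * expR (x / 2)) ^+ 2 <= 1.
  by rewrite exprn_ile1 // mulr_ge0 // ltW.
have h4 : 1 <= (1 - x / 2) ^+ 2 * (x + (1 + 2 * x ^+ 2)).
  have : 0 <= x ^+ 2 * (5 / 4 - 7 / 4 * x + x ^+ 2 / 2).
    rewrite mulr_ge0 ?sqr_ge0 //.
    have := sqr_ge0 x; lra.
  lra.
have pp : 0 < (1 - x / 2) ^+ 2 by rewrite exprn_gt0.
by rewrite -(ler_pM2l pp); apply: le_trans h4; rewrite -exprMn.
Qed.

Lemma skewed_mgf (s : R) :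
  3^-1 * expR (s * 2) + (1 - 3^-1) * expR (s * -1) <= expR (8 * s ^+ 2).
Proof.
have h1 := expR_le_quadratic (s * 2); have h2 := expR_le_quadratic (s * -1).
have -> : 8 * s ^+ 2 = 2 * (s * 2) ^+ 2 by ring.
have : expR (2 * (s * -1) ^+ 2) <= expR (2 * (s * 2) ^+ 2).
  by rewrite ler_expR; have := sqr_ge0 s; lra.
lra.
Qed.

Lemma exp_moment (x : R) (l : nat) (t : R) : 0 < t -> (0 < l)%N -> ~~ odd l ->
  x ^+ l <= (l%:R / t) ^+ l * (expR (t * x) + expR (t * - x)).
Proof.
move=> t0 l0 le.
have lp : 0 < l%:R :> R by rewrite ltr0n.
have -> : x ^+ l = `|x| ^+ l.
  by rewrite -normrX ger0_norm // exprn_even_ge0.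
have h : (t * `|x| / l%:R) ^+ l <= expR (t * `|x|).
  have -> : expR (t * `|x|) = expR (t * `|x| / l%:R) ^+ l.
    by rewrite -expRM_natr mulfVK ?gt_eqF.
  rewrite lerXn2r ?nnegrE ?expR_ge0 //.
    by rewrite divr_ge0 ?mulr_ge0 // ltW.
  by have := expR_ge1Dx (t * `|x| / l%:R); lra.
have -> : `|x| ^+ l = (l%:R / t) ^+ l * (t * `|x| / l%:R) ^+ l.
  by rewrite -exprMn; congr (_ ^+ _); field; rewrite !gt_eqF.
rewrite ler_pM2l ?exprn_gt0 ?divr_gt0 //; apply: le_trans h _.
have := expR_ge0 (t * x); have := expR_ge0 (t * - x).
by case: (ler0P x) => _; lra.
Qed.

(** The bilinear form of [sym_mx] as a linear form in the independent entries. *)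
Lemma dot_sym_mx n (b : bool -> R) w (x y : 'cV[R]_n) :
  dot x (sym_mx b w *m y) =
  \sum_(e : 'I_n * 'I_n | (e.1 < e.2)%N)
     b (w e) * (x e.1 0 * y e.2 0 + x e.2 0 * y e.1 0).
Proof.
rewrite dot_mulmx pair_big /= (bigID (fun e : 'I_n * 'I_n => e.1 < e.2)%N) /=.
rewrite [X in _ + X](bigID (fun e : 'I_n * 'I_n => e.1 == e.2)) /=.
rewrite [X in _ + (X + _)]big1 ?add0r => [|e /andP[_ ee]]; last first.
  by rewrite mxE ee mulr0 mul0r.
rewrite [X in _ + X](reindex_inj (h := fun e : 'I_n * 'I_n => (e.2, e.1))) /=; last first.
  by case=> [a c] [a' c'] [-> ->].
rewrite [X in _ + X](eq_bigl (fun e : 'I_n * 'I_n => (e.1 < e.2)%N)); last first.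
  by case=> a c /=; rewrite -val_eqE /=; case: ltngtP.
rewrite -big_split /=; apply: eq_bigr => -[i j] /= ij; rewrite !mxE.
have ne : (i == j) = false by apply/negbTE; rewrite -val_eqE /=; lia.
rewrite [j == i]eq_sym ne (edge_keyC j) /edge_key ij; ring.
Qed.

(** For unit vectors the form is subgaussian, whence moments of order [l]
bounded by [(C l) ^ (l / 2)]. *)
Lemma skewed_form_moment n (x y : 'cV[R]_n) (l : nat) :
  dot x x <= 1 -> dot y y <= 1 -> (0 < l)%N -> ~~ odd l ->
  bern_mean (@edge_prob R n 3^-1)
    (fun w => dot x (sym_mx (@skewed R) w *m y) ^+ l) <=
  2 * expR 16 ^+ l * l%:R ^+ l./2.
Proof.
move=> x1 y1 l0 le; have p01 e : 0 <= @edge_prob R n 3^-1 e <= 1.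
  by apply: edge_prob01; lra.
(* The parameter [sqrt l] balances [(l / t) ^ l] and [exp (16 t ^ 2)]. *)
pose t : R := Num.sqrt l%:R.
have lp : 0 < l%:R :> R by rewrite ltr0n.
have t0 : 0 < t by rewrite sqrtr_gt0.
have tt : t ^+ 2 = l%:R by rewrite sqr_sqrtr // ltW.
have mgf (u v : 'cV[R]_n) : dot u u <= 1 -> dot v v <= 1 ->
    bern_mean (@edge_prob R n 3^-1)
    (fun w => expR (t * dot u (sym_mx (@skewed R) w *m v))) <= expR 16 ^+ l.
  move=> u1 v1.
  pose a (e : 'I_n * 'I_n) : R := if (e.1 < e.2)%N then
     t * (u e.1 0 * v e.2 0 + u e.2 0 * v e.1 0) else 0.
  have -> : bern_mean (@edge_prob R n 3^-1)
      (fun w => expR (t * dot u (sym_mx (@skewed R) w *m v))) =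
      bern_mean (@edge_prob R n 3^-1)
      (fun w => \prod_e expR (a e * skewed R (w e))).
    apply: eq_bern_mean => w; rewrite dot_sym_mx mulr_sumr big_mkcond -expR_sum.
    congr expR; apply: eq_bigr => e _; rewrite /a; case: ifP => _; ring.
  rewrite (bern_mean_prod _ (fun e c => expR (a e * skewed R c))).
  apply: (@le_trans _ _ (\prod_e expR (8 * a e ^+ 2))).
    apply: ler_prod => e _; apply/andP; split.
      have /andP[q0 q1] := p01 e.
      by rewrite addr_ge0 // mulr_ge0 ?expR_ge0 // subr_ge0.
    rewrite /edge_prob /a; case: ifP => _; first exact: skewed_mgf.
    by rewrite !mul0r expr0n mulr0 expR0; lra.
  rewrite -expR_sum -expRM_natr ler_expR -mulr_sumr -tt.
  suff : \sum_e a e ^+ 2 <= 2 * t ^+ 2 by lra.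
  apply: (@le_trans _ _ (\sum_(e : 'I_n * 'I_n)
      2 * t ^+ 2 * (u e.1 0 ^+ 2 * v e.2 0 ^+ 2))); last first.
    rewrite -mulr_sumr ler_piMr ?mulr_ge0 ?sqr_ge0 ?(ltW t0) //.
    have -> : \sum_(e : 'I_n * 'I_n) u e.1 0 ^+ 2 * v e.2 0 ^+ 2 =
        dot u u * dot v v.
      rewrite /dot big_distrlr /= pair_big; apply: eq_bigr => e _.
      by rewrite !expr2.
    by rewrite mulr_ile1 ?dot_ge0.
  rewrite [leRHS](bigID (fun e : 'I_n * 'I_n => e.1 < e.2)%N) /=.
  rewrite [leLHS](bigID (fun e : 'I_n * 'I_n => e.1 < e.2)%N) /=.
  rewrite [X in _ + X <= _]big1 ?addr0 => [|e /negbTE ee]; last first.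
    by rewrite /a ee expr0n.
  apply: (@le_trans _ _ (\sum_(e : 'I_n * 'I_n | (e.1 < e.2)%N)
      2 * t ^+ 2 * (u e.1 0 ^+ 2 * v e.2 0 ^+ 2) +
      \sum_(e : 'I_n * 'I_n | (e.1 < e.2)%N)
      2 * t ^+ 2 * (u e.2 0 ^+ 2 * v e.1 0 ^+ 2))).
    rewrite -big_split /=; apply: ler_sum => e ee; rewrite /a ee.
    set c := u e.1 0 * v e.2 0; set d := u e.2 0 * v e.1 0.
    rewrite -!exprMn -/c -/d exprMn -mulrDr.
    have -> : 2 * t ^+ 2 * (c ^+ 2 + d ^+ 2) = t ^+ 2 * (2 * (c ^+ 2 + d ^+ 2)) by ring.
    rewrite ler_wpM2l ?sqr_ge0 //; have := sqr_ge0 (c - d); lra.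
  rewrite lerD2l.
  rewrite [leLHS](reindex_inj (h := fun e : 'I_n * 'I_n => (e.2, e.1))) /=; last first.
    by case=> [c d] [c' d'] [-> ->].
  rewrite [leRHS]big_mkcond [leLHS]big_mkcond /=; apply: ler_sum => e _.
  have pos : 0 <= 2 * t ^+ 2 * (u e.1 0 ^+ 2 * v e.2 0 ^+ 2).
    by apply: mulr_ge0; [apply: mulr_ge0 => //|apply: mulr_ge0]; exact: sqr_ge0.
  by case: ifP => h1; case: ifP => h2 //; exfalso; lia.
apply: (@le_trans _ _ (bern_mean (@edge_prob R n 3^-1) (fun w =>
   (l%:R / t) ^+ l * (expR (t * dot x (sym_mx (@skewed R) w *m y)) +
      expR (t * dot (- x) (sym_mx (@skewed R) w *m y)))))).
  apply: ler_bern_mean => // w; rewrite dotNl.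
  exact: exp_moment.
rewrite bern_meanZ bern_meanD.
have -> : (l%:R / t) ^+ l = l%:R ^+ l./2.
  have -> : l%:R / t = t by rewrite -tt expr2 mulfK // gt_eqF.
  rewrite -[in LHS](odd_double_half l) (negbTE le) add0n -muln2 mulnC exprM tt.
  by [].
have h1 := mgf x y x1 y1.
have h2 : bern_mean (@edge_prob R n 3^-1) (fun w =>
   expR (t * dot (- x) (sym_mx (@skewed R) w *m y))) <= expR 16 ^+ l.
  by apply: mgf => //; rewrite dotNl dotNr opprK.
rewrite mulrC ler_wpM2r ?exprn_ge0 ?ler0n //; apply: le_trans (lerD h1 h2) _.
by rewrite mulr_natl mulr2n.
Qed.

End Net.

(** * Norm moments by a grid on the unit ball *)

Section NormMoment.
Variable R : realType.

Lemma l2norm_pow n (M : 'M[R]_n) l x :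
  l2norm (M ^+ l *m x) <= opnorm M ^+ l * l2norm x.
Proof.
elim: l => [|l IH]; first by rewrite !expr0 mul1mx mul1r.
rewrite !exprS -mulmxA; apply: le_trans (l2norm_opnorm _ _) _.
by rewrite -mulrA ler_wpM2l ?opnorm_ge0.
Qed.

Lemma l2norm_delta n (i : 'I_n) : l2norm (delta_mx i 0 : 'cV[R]_n) = 1.
Proof.
rewrite l2normE /dot (bigD1 i) //= !mxE !eqxx mulr1 big1 ?addr0 ?sqrtr1 //.
by move=> j /negbTE ne; rewrite mxE ne mul0r.
Qed.

Lemma trace_pow_le n (M : 'M[R]_n) l : \tr (M ^+ l) <= n%:R * opnorm M ^+ l.
Proof.
rewrite -[n in n%:R]card_ord mulr_natl -sumr_const; apply: ler_sum => i _.
have -> : (M ^+ l) i i = dot (delta_mx i 0) (M ^+ l *m delta_mx i 0).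
  rewrite dot_mulmx (bigD1 i) //= (bigD1 i) //= !mxE !eqxx mul1r mulr1.
  rewrite !big1 ?addr0 // => j /negbTE ne.
    by rewrite big1 // => k _; rewrite mxE ne !mul0r.
  by rewrite !mxE ne mulr0.
apply: le_trans (dot_le_l2norm _ _) _; rewrite l2norm_delta mul1r.
by apply: le_trans (l2norm_pow _ _ _) _; rewrite l2norm_delta mulr1.
Qed.

(** The point of the grid of mesh [h] with the given signs and absolute
values. *)
Definition grid_point r N (h : R) (z : {ffun 'I_r -> bool * 'I_N}) : 'cV[R]_r :=
  \col_i (h * (-1) ^+ (z i).1 * (z i).2%:R).

(** Rounding each coordinate towards zero keeps the point in the unit ball. *)
Lemma grid_approx r (h : R) (x : 'cV[R]_r) : 0 < h -> 16 * r%:R * h ^+ 2 = 1 ->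
  dot x x <= 1 ->
  exists z : {ffun 'I_r -> bool * 'I_(4 * r).+1},
    let y := grid_point h z in
    dot y y <= 1 /\ dot (x - y) (x - y) <= 1 / 16.
Proof.
move=> h0 rh x1.
have xi1 i : x i 0 ^+ 2 <= 1.
  apply: le_trans x1; rewrite /dot (bigD1 i) //= -expr2 lerDl.
  by apply: sumr_ge0 => j _; rewrite -expr2 sqr_ge0.
have hi : h^-1 <= (4 * r)%:R.
  have r1 : 1 <= r%:R :> R.
    by rewrite ler1n lt0n; apply: contra_eq_neq rh => ->; rewrite mulr0 mul0r eq_sym oner_eq0.
  rewrite -ler_sqr ?nnegrE ?invr_ge0 ?(ltW h0) ?ler0n // natrM exprMn exprVn.
  have -> : h ^- 2 = 16 * r%:R.
    have hh : h ^+ 2 != 0 by rewrite expf_neq0 // gt_eqF.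
    by apply: (mulIf hh); rewrite mulVf.
  have : r%:R * 1 <= r%:R * r%:R :> R by rewrite ler_wpM2l.
  lra.
pose k i := Num.trunc (`|x i 0| / h).
have xh0 i : 0 <= `|x i 0| / h by rewrite divr_ge0 // ltW.
have kN i : (k i < (4 * r).+1)%N.
  rewrite ltnS -(ler_nat R); apply: le_trans hi.
  have /andP[+ _] := truncn_itv (xh0 i) => /le_trans; apply.
  rewrite ler_piMl ?invr_ge0 ?(ltW h0) //.
  by rewrite -(@ler_sqr _ _ 1) ?nnegrE // real_normK ?num_real // expr1n.
pose z : {ffun 'I_r -> bool * 'I_(4 * r).+1} :=
  [ffun i => (x i 0 < 0, Ordinal (kN i))].
exists z => y.
have yE i : y i 0 = (-1) ^+ (x i 0 < 0)%R * (h * (k i)%:R).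
  by rewrite mxE ffunE /=; ring.
have xE i : x i 0 = (-1) ^+ (x i 0 < 0)%R * `|x i 0| by rewrite -[LHS]mulr_sign_norm.
have sg i : ((-1) ^+ (x i 0 < 0)%R) ^+ 2 = 1 :> R by rewrite sqrr_sign.
have kle i : h * (k i)%:R <= `|x i 0|.
  have /andP[+ _] := truncn_itv (xh0 i).
  by rewrite ler_pdivlMr // mulrC.
have kge i : `|x i 0| - h * (k i)%:R <= h.
  have /andP[_] := truncn_itv (xh0 i); rewrite ltr_pdivrMr // -natr1 mulrDl mul1r.
  rewrite -/(k i) mulrC; lra.
split.
  apply: le_trans x1; apply: ler_sum => i _; rewrite -!expr2 yE exprMn sg mul1r.
  rewrite -[leRHS]real_normK ?num_real // ler_sqr ?nnegrE //.
  by rewrite mulr_ge0 ?(ltW h0) //.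
have -> : 1 / 16 = \sum_(i < r) h ^+ 2.
  rewrite sumr_const card_ord -mulr_natl; lra.
apply: ler_sum => i _.
have -> : (x - y) i 0 = x i 0 - y i 0 by rewrite [LHS]mxE [X in _ + X]mxE.
rewrite -expr2 yE.
rewrite {1}xE -mulrBr exprMn sg mul1r ler_sqr ?nnegrE ?(ltW h0) //.
by rewrite subr_ge0.
Qed.

(** The number of grid points of mesh [1 / (4 sqrt r)] in the unit ball is
exponential in the dimension: a point of the ball satisfies
[sum_i (z i).2 <= 16 r], so that [2 ^ (16 r - sum_i (z i).2) >= 1], and the sum
of the latter over all [z] is a product of geometric series. *)
Lemma grid_card r N (h : R) : 0 < h -> 16 * r%:R * h ^+ 2 = 1 ->
  #|[set z : {ffun 'I_r -> bool * 'I_N} |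
      dot (grid_point h z) (grid_point h z) <= 1]|%:R <= 2 ^+ (18 * r) :> R.
Proof.
move=> h0 rh; rewrite cardsE -sum1_card natr_sum big_mkcond /=.
pose g (c : bool * 'I_N) : R := 2^-1 ^+ c.2.
apply: (@le_trans _ _ (\sum_(z : {ffun 'I_r -> bool * 'I_N})
   2 ^+ (16 * r) * \prod_i g (z i))).
  apply: ler_sum => z _; case: ifP => [|_]; last first.
    by rewrite mulr_ge0 ?exprn_ge0 // prodr_ge0 // => i _; rewrite exprn_ge0 ?invr_ge0.
  rewrite -topredE /= => zP.
  (* For naturals [k <= k ^ 2], hence the sum is at most the sum of the
   squares, which is at most [h ^ -2]. *)
  have s16 : (\sum_i (z i).2 <= 16 * r)%N.
    rewrite -(ler_nat R) natr_sum natrM.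
    have hh : 0 < h ^+ 2 by rewrite exprn_gt0.
    rewrite -(ler_pM2l hh).
    have -> : h ^+ 2 * (16%:R * r%:R) = 1 by rewrite mulrC.
    apply: le_trans zP; rewrite mulr_sumr; apply: ler_sum => i _.
    rewrite mxE -expr2 !exprMn sqrr_sign mulr1 ler_wpM2l ?(ltW hh) //.
    by rewrite -natrX ler_nat; case: (val (z i).2) => // m; rewrite expnS leq_pmulr.
  have -> : \prod_i g (z i) = 2^-1 ^+ (\sum_i (z i).2).
    by rewrite prodrXr.
  rewrite exprVn -(subnK s16) exprD mulfK; last by rewrite expf_neq0 // pnatr_eq0.
  by rewrite exprn_ege1 // ler1n.
rewrite -mulr_sumr -(bigA_distr_bigA (fun=> g)) /= prodr_const card_ord.
have -> : (18 * r = 16 * r + 2 * r)%N by lia.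
rewrite exprD ler_wpM2l ?exprn_ge0 // exprM; apply: lerXn2r.
- by rewrite nnegrE sumr_ge0 // => c _; rewrite exprn_ge0 // invr_ge0.
- by rewrite nnegrE exprn_ge0.
rewrite -(pair_bigA _ (fun (b : bool) (j : 'I_N) => 2^-1 ^+ j)) /= big_bool /=.
have geo m : \sum_(j < m) (2^-1 : R) ^+ j <= 2 - 2 * 2^-1 ^+ m.
  elim: m => [|m IH]; first by rewrite big_ord0 expr0; lra.
  rewrite big_ord_recr /= exprSr; lra.
have := geo N; have : 0 <= (2^-1 : R) ^+ N by rewrite exprn_ge0 // invr_ge0.
rewrite expr2; lra.
Qed.

(** The bilinear form on the grid controls the operator norm. *)
Lemma opnorm_grid r (M : 'M[R]_r) (h D : R) :  0 < h -> 16 * r%:R * h ^+ 2 = 1 ->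
  0 <= D ->
  (forall z z' : {ffun 'I_r -> bool * 'I_(4 * r).+1},
    dot (grid_point h z) (grid_point h z) <= 1 ->
    dot (grid_point h z') (grid_point h z') <= 1 ->
    dot (grid_point h z) (M *m grid_point h z') <= D) ->
  opnorm M <= 2 * D.
Proof.
move=> h0 rh D0 HD; set s := opnorm M.
have s0 : 0 <= s by exact: opnorm_ge0.
suff : s <= D + s / 2 by lra.
have unit_form (x y : 'cV[R]_r) : dot x x <= 1 -> dot y y <= 1 ->
    dot y (M *m x) <= D + s / 2.
  move=> x1 y1; have [z [zx xz]] := grid_approx h0 rh x1.
  have [z' [zy yz]] := grid_approx h0 rh y1.
  have := HD _ _ zy zx; set x' := grid_point h z in zx xz *.
  set y' := grid_point h z' in zy yz * => h1.
  have nle (u : 'cV[R]_r) c : 0 <= c -> dot u u <= c ^+ 2 -> l2norm u <= c.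
    by move=> c0; rewrite l2norm_le.
  have h2 : dot (y - y') (M *m x) <= s / 4.
    apply: le_trans (dot_le_l2norm _ _) _.
    have a1 : l2norm (y - y') <= 1 / 4 by apply: nle; lra.
    have a2 : l2norm (M *m x) <= s.
      apply: le_trans (l2norm_opnorm _ _) _; rewrite ler_piMr //.
      by apply: nle; rewrite ?expr1n.
    have -> : s / 4 = 1 / 4 * s by field.
    by apply: ler_pM; rewrite ?l2norm_ge0.
  have h3 : dot y' (M *m (x - x')) <= s / 4.
    apply: le_trans (dot_le_l2norm _ _) _.
    have a1 : l2norm y' <= 1 by apply: nle; rewrite ?expr1n.
    have a2 : l2norm (M *m (x - x')) <= s / 4.
      apply: le_trans (l2norm_opnorm _ _) _.
      have -> : s / 4 = s * (1 / 4) by field.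
      by apply: ler_wpM2l => //; apply: nle; lra.
    have -> : s / 4 = 1 * (s / 4) by rewrite mul1r.
    by apply: ler_pM; rewrite ?l2norm_ge0.
  move: h2 h3; rewrite mulmxBr dotBl dotBr; lra.
apply: ge_sup; first by case: (opnorm_has_sup M).
move=> _ [x /= x1 <-].
have {}x1 : dot x x <= 1 by move: x1; rewrite l2norm_le // expr1n.
have [->|ne] := eqVneq (l2norm (M *m x)) 0; first by lra.
have p : 0 < l2norm (M *m x) by rewrite lt_def ne l2norm_ge0.
have := unit_form x ((l2norm (M *m x))^-1 *: (M *m x)) x1.
rewrite !dotE -!l2norm_sq; set N := l2norm (M *m x) in ne *.
have -> : N^-1 * (N^-1 * N ^+ 2) = 1 by field.
have -> : N^-1 * N ^+ 2 = N by field.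
by apply.
Qed.

Lemma opnorm_pow_grid r (M : 'M[R]_r) (h : R) l :
  0 < h -> 16 * r%:R * h ^+ 2 = 1 -> ~~ odd l -> (0 < l)%N ->
  opnorm M ^+ l <= 2 ^+ l * \sum_(z : {ffun 'I_r -> bool * 'I_(4 * r).+1} |
      dot (grid_point h z) (grid_point h z) <= 1)
    \sum_(z' : {ffun 'I_r -> bool * 'I_(4 * r).+1} |
      dot (grid_point h z') (grid_point h z') <= 1)
      dot (grid_point h z) (M *m grid_point h z') ^+ l.
Proof.
move=> h0 rh le l0; set S := \sum_(z | _) _.
pose D := Num.max 0 (\big[Num.max/0]_(c : {ffun 'I_r -> bool * 'I_(4 * r).+1} *
   {ffun 'I_r -> bool * 'I_(4 * r).+1} |
   (dot (grid_point h c.1) (grid_point h c.1) <= 1) &&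
   (dot (grid_point h c.2) (grid_point h c.2) <= 1))
   dot (grid_point h c.1) (M *m grid_point h c.2)).
have pos (a : R) : 0 <= a ^+ l by rewrite exprn_even_ge0.
have S0 : 0 <= S by apply: sumr_ge0 => z _; apply: sumr_ge0.
have DS : D ^+ l <= S.
  rewrite /D; apply: (big_ind (fun d => Num.max 0 d ^+ l <= S)).
  - by rewrite maxxx expr0n gtn_eqF.
  - by move=> a b ha hb; case: (leP a b).
  case=> z z' /= /andP[zP zP'].
  case: (ler0P (dot (grid_point h z) (M *m grid_point h z'))) => _.
    by rewrite expr0n gtn_eqF.
  rewrite /S (bigD1 z) //= (bigD1 z') //= -addrA lerDl addr_ge0 //.
    by apply: sumr_ge0.
  by apply: sumr_ge0 => ? _; apply: sumr_ge0.
have D0 : 0 <= D by rewrite le_max lexx.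
have : opnorm M <= 2 * D.
  apply: (opnorm_grid h0 rh D0) => z z' zP zP'.
  rewrite le_max; apply/orP; right.
  by rewrite (bigD1 (z, z')) /= ?zP ?zP' // le_max lexx.
move=> H; apply: (@le_trans _ _ ((2 * D) ^+ l)).
  by rewrite lerXn2r ?nnegrE ?opnorm_ge0 // mulr_ge0.
by rewrite exprMn ler_wpM2l ?exprn_ge0.
Qed.

(** The dimension [2 l] being proportional to the order [l] of the moment, the
union bound over the grid costs only a factor [C ^ l]. *)
Lemma skewed_trace_moment : exists2 K : R, 0 < K & forall l, ~~ odd l -> (0 < l)%N ->
  bern_mean (@edge_prob R (2 * l) 3^-1) (fun w => \tr (sym_mx (@skewed R) w ^+ l))
    <= (2 * l)%:R * (K ^+ l * l%:R ^+ l./2).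
Proof.
exists (2 * (2 ^+ 72) * 2 * expR 16).
  by rewrite !mulr_gt0 ?expR_gt0 // exprn_gt0.
move=> l le l0; have p01 e : 0 <= @edge_prob R (2 * l) 3^-1 e <= 1.
  by apply: edge_prob01; lra.
set r := (2 * l)%N.
have rp : 0 < r%:R :> R by rewrite ltr0n /r; lia.
pose h : R := (4 * Num.sqrt r%:R)^-1.
have h0 : 0 < h by rewrite invr_gt0 mulr_gt0 // sqrtr_gt0.
have rh : 16 * r%:R * h ^+ 2 = 1.
  rewrite exprVn exprMn sqr_sqrtr ?ler0n // (_ : 4 ^+ 2 = 16 :> R); last by ring.
  by rewrite mulfV // mulf_neq0 ?pnatr_eq0 // /r; lia.
apply: (@le_trans _ _ (bern_mean (@edge_prob R r 3^-1) (fun w =>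
   r%:R * (2 ^+ l * \sum_(z : {ffun 'I_r -> bool * 'I_(4 * r).+1} |
      dot (grid_point h z) (grid_point h z) <= 1)
    \sum_(z' : {ffun 'I_r -> bool * 'I_(4 * r).+1} |
      dot (grid_point h z') (grid_point h z') <= 1)
      dot (grid_point h z) (sym_mx (@skewed R) w *m grid_point h z') ^+ l)))).
  apply: ler_bern_mean => // w; apply: le_trans (trace_pow_le _ _) _.
  by rewrite ler_wpM2l ?ler0n // opnorm_pow_grid.
rewrite bern_meanZ ler_wpM2l ?ler0n // bern_meanZ bern_mean_sum.
set B : R := 2 * expR 16 ^+ l * l%:R ^+ l./2.
have B0 : 0 <= B by rewrite !mulr_ge0 ?exprn_ge0 ?expR_ge0.
pose G := [set z : {ffun 'I_r -> bool * 'I_(4 * r).+1} | dot (grid_point h z) (grid_point h z) <= 1].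
apply: (@le_trans _ _ (2 ^+ l * (#|G|%:R * (#|G|%:R * B)))).
  rewrite ler_wpM2l ?exprn_ge0 //.
  have SG (c : R) : #|G|%:R * c = \sum_(z in G) c by rewrite sumr_const mulr_natl.
  rewrite !SG big_set; apply: ler_sum => z zP; rewrite bern_mean_sum big_set.
  by apply: ler_sum => z' zP'; apply: skewed_form_moment.
have cG : #|G|%:R <= 2 ^+ (18 * r) :> R by apply: grid_card.
apply: (@le_trans _ _ (2 ^+ l * (2 ^+ (18 * r) * (2 ^+ (18 * r) * B)))).
  rewrite ler_wpM2l ?exprn_ge0 //; apply: ler_pM => //.
    by rewrite mulr_ge0.
  by rewrite ler_wpM2r.
set c72 : R := 2 ^+ 72.
have c72E : c72 ^+ l = 2 ^+ (18 * r) * 2 ^+ (18 * r).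
  by rewrite -exprD -exprM; congr (_ ^+ _); rewrite /r; lia.
clearbody c72; rewrite !exprMn c72E /B.
have h2 : (2 : R) <= 2 ^+ l by case: (l) l0 => // m _; rewrite exprS ler_peMr ?exprn_ege1 ?ler1n.
set X := 2 ^+ (18 * r); set E := expR 16 ^+ l; set Q := l%:R ^+ l./2.
have X0 : 0 <= X by rewrite exprn_ge0.
have E0 : 0 <= E by rewrite exprn_ge0 ?expR_ge0.
have Q0 : 0 <= Q by rewrite exprn_ge0 ?ler0n.
have -> : 2 ^+ l * (X * (X * (2 * E * Q))) = 2 ^+ l * (X * X) * E * Q * 2 by ring.
have -> : 2 ^+ l * (X * X) * 2 ^+ l * E * Q = 2 ^+ l * (X * X) * E * Q * 2 ^+ l by ring.
by rewrite ler_wpM2l // !mulr_ge0 ?exprn_ge0.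
Qed.

End NormMoment.

(** * Tail of the norm of the centred adjacency matrix *)

Section Tail.
Variable R : realType.

Lemma sym_mx_tr n (b : bool -> R) (w : {ffun 'I_n * 'I_n -> bool}) :
  (sym_mx b w)^T = sym_mx b w.
Proof. by apply/matrixP => i j; rewrite !mxE eq_sym edge_keyC. Qed.

Lemma opnorm_sqr_le n (M : 'M[R]_n) : M^T = M -> opnorm M ^+ 2 <= opnorm (M *m M).
Proof.
move=> symM; rewrite -[leRHS]sqr_sqrtr ?opnorm_ge0 //.
rewrite ler_sqr ?nnegrE ?opnorm_ge0 ?sqrtr_ge0 //.
apply: opnorm_le => [|x]; first by rewrite sqrtr_ge0.
rewrite -ler_sqr ?nnegrE ?mulr_ge0 ?l2norm_ge0 ?sqrtr_ge0 //.
rewrite exprMn (sqr_sqrtr (opnorm_ge0 _)) !l2norm_sq.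
by rewrite dot_tr symM mulmxA dotC dot_opnorm.
Qed.

Lemma trmx_pow n (M : 'M[R]_n) m : M^T = M -> (M ^+ m)^T = M ^+ m.
Proof.
move=> symM; elim: m => [|m IH]; first by rewrite expr0 trmx1.
by rewrite [in LHS]exprS trmx_mul symM IH exprSr.
Qed.

Lemma opnorm_pow2_le n (M : 'M[R]_n) m : M^T = M ->
  opnorm M ^+ (2 ^ m) <= opnorm (M ^+ (2 ^ m)).
Proof.
elim: m M => [|m IH] M symM; first by rewrite !expr1.
rewrite expnS !exprM.
apply: (@le_trans _ _ (opnorm (M ^+ 2) ^+ (2 ^ m))).
  by rewrite lerXn2r ?nnegrE ?exprn_ge0 ?opnorm_ge0 // expr2 opnorm_sqr_le.
by apply: IH; rewrite trmx_pow.
Qed.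

(** The exponent is a power of two so that the bound follows by repeated
squaring, without diagonalization. *)
Lemma opnorm_pow_trace n (M : 'M[R]_n) m : M^T = M ->
  opnorm M ^+ (2 ^ m.+1) <= \tr (M ^+ (2 ^ m.+1)).
Proof.
move=> symM; rewrite expnS mulnC !exprM.
set C := M ^+ (2 ^ m); have symC : C^T = C by rewrite trmx_pow.
have -> : \tr (C ^+ 2) = \sum_i \sum_j C i j ^+ 2.
  apply: eq_bigr => i _; rewrite expr2 mxE; apply: eq_bigr => j _.
  have -> : C j i = C i j by rewrite -{1}symC mxE.
  by rewrite expr2.
set F := \sum_i _; have F0 : 0 <= F.
  by apply: sumr_ge0 => i _; apply: sumr_ge0 => j _; rewrite sqr_ge0.
apply: (@le_trans _ _ (opnorm C ^+ 2)).
  by rewrite ler_sqr ?nnegrE ?exprn_ge0 ?opnorm_ge0 // opnorm_pow2_le.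
rewrite -[leRHS]sqr_sqrtr // ler_sqr ?nnegrE ?opnorm_ge0 ?sqrtr_ge0 //.
apply: opnorm_le => [|x]; first by rewrite sqrtr_ge0.
rewrite -ler_sqr ?nnegrE ?mulr_ge0 ?l2norm_ge0 ?sqrtr_ge0 //.
by rewrite exprMn (sqr_sqrtr F0) !l2norm_sq frobenius_bound.
Qed.

(** The norm of the centred matrix is of order [sqrt l] with probability at
least [1 - 1 / n], as soon as [l] is a power of two above [n p] and [ln n]. *)
Lemma opnorm_centered_tail : exists2 K : R, 0 < K &
  forall (n m : nat) (p s : R), let l := (2 ^ m.+1)%N in
  (0 < n)%N -> 0 <= p <= 1 -> n%:R * p <= l%:R -> ln n%:R <= l%:R :> R ->
  0 < s -> K * l%:R <= s ^+ 2 ->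
  bern_mean (@edge_prob R n p)
    (fun w => (s < opnorm (sym_mx (centered p) w))%R%:R) <= n%:R^-1.
Proof.
have [K0 K0p HK] := skewed_trace_moment R.
exists (K0 ^+ 2 * expR 4); first by rewrite mulr_gt0 ?expR_gt0 // exprn_gt0.
move=> n m p s l n0 p01 npl lnl s0 Kl.
have l0 : (0 < l)%N by rewrite expn_gt0.
have le : ~~ odd l by rewrite oddX.
have np : 0 < n%:R :> R by rewrite ltr0n.
have lp : 0 < l%:R :> R by rewrite ltr0n.
have sp : 0 < s ^+ l by rewrite exprn_gt0.
have q01 := @edge_prob01 R n p p01.
apply: (@le_trans _ _ ((s ^+ l)^-1 * bern_mean (@edge_prob R n p)
    (fun w => \tr (sym_mx (centered p) w ^+ l)))).
  rewrite -bern_meanZ; apply: ler_bern_mean => // w.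
  have h := opnorm_pow_trace m (sym_mx_tr (centered p) w).
  rewrite ler_pdivlMl //; apply: le_trans h; rewrite -/l.
  case: (ltP s _) => hs; rewrite ?mulr1 ?mulr0 ?exprn_ge0 ?opnorm_ge0 //.
  by rewrite lerXn2r ?nnegrE ?opnorm_ge0 // ltW.
rewrite ler_pdivrMl //.
have h1 : l%:R + n%:R * p <= (2 * l)%:R by rewrite natrM; lra.
have := @trace_centered_le R n (2 * l) l p p01 h1 n0 _ _.
have l20 : (0 < 2 * l)%N by rewrite muln_gt0.
have l2 : (l < 2 * l)%N by rewrite mul2n -addnn -[X in (X < _)%N]addn0 ltn_add2l.
move=> /(_ l20 l2) h2; apply: le_trans h2 _.
apply: (@le_trans _ _ (n%:R * (K0 ^+ l * l%:R ^+ l./2))).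
  rewrite mulrAC ler_pdivrMr ?ltr0n //.
  rewrite -mulrA ler_wpM2l ?(ltW np) //.
  by apply: le_trans (HK l le l0) _; rewrite mulrC.
set k := l./2.
have lk : l = (2 * k)%N by rewrite -[LHS](odd_double_half l) (negbTE le) add0n -mul2n.
rewrite [in K0 ^+ l]lk [in s ^+ l]lk !exprM -exprMn.
have -> : s ^+ 2 ^+ k * n%:R^-1 = n%:R * (s ^+ 2 ^+ k * n%:R^-1 ^+ 2).
  by field; rewrite gt_eqF.
rewrite ler_wpM2l ?(ltW np) //.
have h3 : (K0 ^+ 2 * expR 4 * l%:R) ^+ k <= (s ^+ 2) ^+ k.
  by rewrite lerXn2r ?nnegrE ?sqr_ge0 // !mulr_ge0 ?expR_ge0 ?exprn_ge0 ?(ltW K0p).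
rewrite mulrAC exprMn in h3.
have h4 : n%:R ^+ 2 <= expR 4 ^+ k :> R.
  have -> : n%:R ^+ 2 = expR (2%:R * ln n%:R) :> R by rewrite expRM_natl lnK // posrE.
  rewrite -expRM_natl ler_expR.
  have : l%:R = 2%:R * k%:R :> R by rewrite {1}lk natrM.
  lra.
have n2 : 0 < n%:R ^+ 2 :> R by rewrite exprn_gt0.
rewrite exprVn ler_pdivlMr //; apply: le_trans h3.
by rewrite ler_wpM2l // exprn_ge0 // mulr_ge0 ?sqr_ge0 ?(ltW lp).
Qed.

End Tail.

(** * The adjacency matrix on the finite probability space *)

Section Graph.
Variable R : realType.
Variable n : nat.
Implicit Types (w : {ffun 'I_n * 'I_n -> bool}).

(** The adjacency matrix of the graph with edge indicators [w]. *)
Definition graph_mx w : 'M[R]_n := sym_mx (fun b : bool => b%:R) w.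
(** The adjacency matrix minus its mean. *)
Definition noise_mx (p : R) w : 'M[R]_n := sym_mx (centered p) w.

Lemma graph_mxE w i j : graph_mx w i j = ((i != j) && w (edge_key i j))%:R.
Proof. by rewrite mxE; case: (i == j). Qed.

Lemma graph_mx_tr w : (graph_mx w)^T = graph_mx w.
Proof. exact: sym_mx_tr. Qed.

Lemma graph_mx_ge0 w i j : 0 <= graph_mx w i j.
Proof. by rewrite graph_mxE ler0n. Qed.

Lemma noise_mxE p w i j : noise_mx p w i j = graph_mx w i j - p * (i != j)%:R.
Proof. by rewrite !mxE /centered; case: (i == j) => /=; ring. Qed.

Lemma noise_mx_mul p w y :
  noise_mx p w *m y = graph_mx w *m y - p *: (dot (ones R n) y *: ones R n - y).
Proof.
apply/matrixP => i j; rewrite ord1 !mxE dot_onesE mulr1.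
rewrite (eq_bigr (fun k => graph_mx w i k * y k 0 - p * ((i != k)%:R * y k 0))).
  rewrite sumrB -mulr_sumr; congr (_ - p * _).
  rewrite (bigD1 i) //= [in RHS](bigD1 i) //= eqxx mul0r add0r.
  by rewrite [in RHS]addrAC subrr add0r; apply: eq_bigr => k ki; rewrite eq_sym ki mul1r.
by move=> k _; rewrite noise_mxE; ring.
Qed.

Lemma dot_ones : dot (ones R n) (ones R n) = n%:R.
Proof.
rewrite dot_onesE (eq_bigr (fun=> 1)) => [|i _]; last by rewrite mxE.
by rewrite sumr_const card_ord.
Qed.

Lemma noise_gap p s w y : 0 <= p -> opnorm (noise_mx p w) <= s ->
  dot (ones R n) y = 0 -> dot y (graph_mx w *m y) <= s * dot y y.
Proof.
move=> p0 Bs y1; have := dot_opnorm (noise_mx p w) y.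
rewrite noise_mx_mul y1 scale0r sub0r !dotE => h.
have : opnorm (noise_mx p w) * dot y y <= s * dot y y by rewrite ler_wpM2r ?dot_ge0.
have := mulr_ge0 p0 (dot_ge0 y); lra.
Qed.

Lemma degree_le p s w i : opnorm (noise_mx p w) <= s ->
  \sum_j graph_mx w i j <= 2 * s ^+ 2 + 2 * (p ^+ 2 * n%:R).
Proof.
move=> Bs.
have h : \sum_j noise_mx p w i j ^+ 2 <= s ^+ 2.
  pose e : 'cV[R]_n := delta_mx i 0.
  have -> : \sum_j noise_mx p w i j ^+ 2 = dot (noise_mx p w *m e) (noise_mx p w *m e).
    apply: eq_bigr => j _.
    have -> : (noise_mx p w *m e) j 0 = noise_mx p w i j.
      rewrite mxE (bigD1 i) //= !mxE !eqxx mulr1 big1 ?addr0 => [|k /negbTE ki].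
        by rewrite eq_sym edge_keyC.
      by rewrite !mxE ki mulr0.
    by rewrite expr2.
  have e1 : l2norm e = 1.
    rewrite l2normE /dot (bigD1 i) //= !mxE !eqxx mulr1 big1 ?addr0 ?sqrtr1 //.
    by move=> j /negbTE ne; rewrite mxE ne mul0r.
  have := l2norm_opnorm (noise_mx p w) e; rewrite e1 mulr1 => h.
  rewrite -l2norm_sq ler_sqr ?nnegrE ?l2norm_ge0 //; first exact: le_trans h Bs.
  exact: le_trans (opnorm_ge0 _) Bs.
apply: (@le_trans _ _ (\sum_j (2 * noise_mx p w i j ^+ 2 + 2 * p ^+ 2))).
  apply: ler_sum => j _; rewrite noise_mxE graph_mxE.
  case: (i != j) => /=; last first.
    by rewrite addr_ge0 // mulr_ge0 ?sqr_ge0.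
  by case: (w _) => /=; have := sqr_ge0 (1 - 2 * p); have := sqr_ge0 p; lra.
rewrite big_split /= -mulr_sumr sumr_const card_ord -[_ *+ n]mulr_natr.
lra.
Qed.

Lemma graph_opnorm_ge p s w : (0 < n)%N -> opnorm (noise_mx p w) <= s ->
  p * (n%:R - 1) - s <= opnorm (graph_mx w).
Proof.
move=> n0 Bs; have np : 0 < n%:R :> R by rewrite ltr0n.
rewrite -(ler_pM2r np).
have := dot_opnorm (graph_mx w) (ones R n); rewrite dot_ones => h.
have : - (s * n%:R) <= dot (ones R n) (noise_mx p w *m ones R n).
  rewrite -lerNl -dotNl; apply: le_trans (dot_le_l2norm _ _) _.
  rewrite -scaleN1r l2normZ normrN1 mul1r.
  apply: (@le_trans _ _ (l2norm (ones R n) * (s * l2norm (ones R n)))).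
    rewrite ler_wpM2l ?l2norm_ge0 //; apply: le_trans (l2norm_opnorm _ _) _.
    by rewrite ler_wpM2r ?l2norm_ge0.
  by rewrite mulrCA -expr2 l2norm_sq dot_ones.
rewrite noise_mx_mul !dotE dot_ones; lra.
Qed.

Lemma graph_top w : (0 < n)%N ->
  top_vector_of (graph_mx w) (top_vector (graph_mx w)).
Proof. by move=> n0; apply: top_vectorP; [| exact: graph_mx_tr| exact: graph_mx_ge0]. Qed.

Lemma graph_gap p s w z : (0 < n)%N -> 0 <= p -> opnorm (noise_mx p w) <= s ->
  s <= opnorm (graph_mx w) -> dot (top_vector (graph_mx w)) z = 0 ->
  dot z (graph_mx w *m z) <= s * dot z z.
Proof.
move=> n0 p0 Bs sl vz; have tv := graph_top w n0; have [v0 v1 Av] := tv.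
apply: (spectral_gap (graph_mx_tr w) Av v1 vz sl (top_vector_sum_gt0 tv)).
by move=> a b y y1; apply: noise_gap p0 Bs y1.
Qed.

(** The sum of the fourth powers of the coordinates, which measures how
localized a unit vector is. *)
Definition fourth_mass (v : 'cV[R]_n) : R := \sum_i v i 0 ^+ 4.

Lemma fourth_mass_ge0 v : 0 <= fourth_mass v.
Proof. by apply: sumr_ge0 => i _; rewrite exprn_even_ge0. Qed.

Lemma fourth_mass_le1 v : dot v v = 1 -> fourth_mass v <= 1.
Proof.
move=> v1; rewrite -[leRHS]v1; apply: ler_sum => i _.
rewrite -expr2 (_ : v i 0 ^+ 4 = v i 0 ^+ 2 * v i 0 ^+ 2); last by rewrite -exprD.
rewrite ler_piMr ?sqr_ge0 // -[leRHS]v1 /dot (bigD1 i) //= -expr2 lerDl.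
by apply: sumr_ge0 => k _; rewrite -expr2 sqr_ge0.
Qed.

(** The graph without the edges at [i] does not depend on these edges. *)
Lemma leave_out_coord w i j b :
  leave_out (graph_mx (set_coord (edge_key i j) b w)) i = leave_out (graph_mx w) i.
Proof.
apply/matrixP => k m; rewrite [LHS]mxE [RHS]mxE; case: ifP => // /norP[ki mi].
rewrite !graph_mxE ffunE edge_key_eq (negbTE ki) (negbTE mi) /=.
by rewrite andbF.
Qed.

Lemma leave_out_top w i : (0 < n)%N ->
  top_vector_of (leave_out (graph_mx w) i) (top_vector (leave_out (graph_mx w) i)).
Proof.
move=> n0; apply: top_vectorP => // [|j k].
  by apply/matrixP => j k; rewrite [LHS]mxE [LHS]mxE [RHS]mxE orbC -[in LHS]graph_mx_tr mxE.
by rewrite mxE; case: ifP => // _; rewrite graph_mx_ge0.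
Qed.

Section Mean.
Variable p : R.
Hypothesis p01 : 0 <= p <= 1.
Local Notation E := (bern_mean (@edge_prob R n p)).
Let q01 := @edge_prob01 R n p p01.

Lemma mean_edge_le i j (g : _ -> R) : (forall w, 0 <= g w) ->
  (forall w b, g (set_coord (edge_key i j) b w) = g w) ->
  E (fun w => graph_mx w i j * g w) <= p * E g.
Proof.
move=> g0 gi; have /andP[p0 p1] := p01.
have [->|ne] := eqVneq i j.
  rewrite (eq_bern_mean _ (g := fun=> 0)) => [|w]; last by rewrite mxE eqxx mul0r.
  by rewrite bern_mean_cst mulr_ge0 // bern_mean_ge0.
rewrite (eq_bern_mean _ (g := fun w => (w (edge_key i j))%:R * g w)) => [|w].
  by rewrite bern_mean_coord // /edge_prob edge_key_lt.
by rewrite graph_mxE ne.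
Qed.

(** Second moment of a weighted count of the neighbours of [i], when the
weights are independent of the edges at [i]. *)
Lemma mean_row_sq_le i (x : _ -> 'cV[R]_n) : (forall w, dot (x w) (x w) = 1) ->
  (forall w j b, x (set_coord (edge_key i j) b w) = x w) ->
  E (fun w => (\sum_j graph_mx w i j * x w j 0 ^+ 2) ^+ 2) <=
  p * E (fun w => fourth_mass (x w)) + p ^+ 2.
Proof.
move=> x1 xi; have /andP[p0 p1] := p01.
rewrite (eq_bern_mean _ (g := fun w => \sum_j \sum_k
   graph_mx w i j * (graph_mx w i k * (x w j 0 ^+ 2 * x w k 0 ^+ 2)))); last first.
  move=> w; rewrite expr2 big_distrlr /=; apply: eq_bigr => j _.
  by apply: eq_bigr => k _; ring.
rewrite bern_mean_sum.
apply: (@le_trans _ _ (\sum_j \sum_k ((if j == k then p * E (fun w => x w j 0 ^+ 4) else 0)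
   + p ^+ 2 * E (fun w => x w j 0 ^+ 2 * x w k 0 ^+ 2)))).
  apply: ler_sum => j _; rewrite bern_mean_sum; apply: ler_sum => k _.
  have pos m : 0 <= p ^+ 2 * E (fun w => x w j 0 ^+ 2 * x w m 0 ^+ 2).
    by rewrite mulr_ge0 ?sqr_ge0 // (bern_mean_ge0 q01) // => w; rewrite mulr_ge0 ?sqr_ge0.
  have [<-|jk] := eqVneq j k.
    apply: (@le_trans _ _ (p * E (fun w => x w j 0 ^+ 4))); last by rewrite lerDl.
    rewrite (eq_bern_mean _ (g := fun w => graph_mx w i j * x w j 0 ^+ 4)).
      apply: mean_edge_le => [w|w b]; first by rewrite exprn_even_ge0.
      by rewrite xi.
    by move=> w; rewrite graph_mxE; case: (_ && _); rewrite /= ?mul0r // !mul1r -exprD.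
  rewrite add0r expr2 -mulrA.
  apply: le_trans (mean_edge_le (i := i) (j := j) _ _) _.
  - by move=> w; apply: mulr_ge0; [exact: graph_mx_ge0|apply: mulr_ge0; exact: sqr_ge0].
  - move=> w b; rewrite xi !graph_mxE; case: (altP (i =P k)) => //= ik.
    rewrite ffunE edge_key_eq eqxx (eq_sym k j) (negbTE jk) (eq_sym k i).
    by rewrite (negbTE ik) /= ?andbF.
  rewrite ler_wpM2l //; apply: mean_edge_le => [w|w b].
    by rewrite mulr_ge0 ?sqr_ge0.
  by rewrite xi.
under eq_bigr => j _ do rewrite big_split /= -big_mkcond /=.
rewrite big_split /=; apply: lerD.
  rewrite bern_mean_sum mulr_sumr le_eqVlt; apply/orP; left; apply/eqP.
  by apply: eq_bigr => j _; rewrite (big_pred1 j) // => k; rewrite eq_sym.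
under eq_bigr => j _ do rewrite -mulr_sumr -bern_mean_sum.
rewrite -mulr_sumr -bern_mean_sum ler_piMr ?sqr_ge0 //.
rewrite (eq_bern_mean _ (g := fun=> 1)) ?bern_mean_cst // => w.
transitivity (dot (x w) (x w) * dot (x w) (x w)); last by rewrite x1 mulr1.
rewrite /dot big_distrlr /=; apply: eq_bigr => j _; apply: eq_bigr => k _.
by rewrite -!expr2.
Qed.

End Mean.
End Graph.

(** * Delocalization and variance on the finite probability space *)

Section Variance.
Variable R : realType.
Variable n : nat.
Variables p s d D : R.
Implicit Types (w : {ffun 'I_n * 'I_n -> bool}).

Hypothesis dE : d = n%:R * p.
Hypothesis DE : D = 2 * (s + 1) ^+ 2 + 2 * (p ^+ 2 * n%:R).

Hypothesis n16 : (16 <= n)%N.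
Hypothesis p01 : 0 <= p <= 1.
Hypothesis d16 : 16 <= d.
Hypothesis s0 : 0 <= s.
Hypothesis sd : s + 1 <= d / 16.
Hypothesis Dd2 : D <= d ^+ 2 / 64.
Hypothesis Dd3 : 1024 * D ^+ 2 <= d ^+ 3.

Local Notation E := (bern_mean (@edge_prob R n p)).
Local Notation G := (@graph_mx R n).
Local Notation B := (@noise_mx R n p).
Local Notation v w := (top_vector (G w)).
Local Notation Z w := (opnorm (G w)).
Let q01 := @edge_prob01 R n p p01.
Let n0 : (0 < n)%N. Proof. exact: leq_trans n16. Qed.
Let np : 0 < n%:R :> R. Proof. by rewrite ltr0n. Qed.
Let d0 : 0 < d. Proof. exact: lt_le_trans d16. Qed.
Let p0 : 0 <= p. Proof. by case/andP: p01. Qed.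

Let ineqs : [/\ 16 <= d, 0 < d, 0 <= s, s + 1 <= d / 16 & 0 <= p].
Proof. by []. Qed.

Hypothesis tail : E (fun w => (s < opnorm (B w))%R%:R) <= n%:R^-1.

(** The event that the norm of the centred matrix is at most [t]. *)
Definition small_noise (t : R) w : bool := opnorm (B w) <= t.

Let p_le : p <= d / 16.
Proof.
have : 16 * p <= n%:R * p by rewrite ler_wpM2r // (ler_nat R 16 n).
rewrite -dE; lra.
Qed.

Lemma small_noise_opnorm w : small_noise (s + 1) w -> 3 / 4 * d <= Z w.
Proof.
have [h16 hd hs hsd hp] := ineqs.
move=> gw; have := graph_opnorm_ge n0 gw.
have -> : p * (n%:R - 1) = d - p by rewrite dE; ring.
have := p_le; lra.
Qed.

Lemma small_noise_gap w z : small_noise (s + 1) w -> dot (v w) z = 0 ->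
  dot z (G w *m z) <= (s + 1) * dot z z.
Proof.
have [h16 hd hs hsd hp] := ineqs.
move=> gw; apply: (graph_gap n0 p0 gw).
by have := small_noise_opnorm gw; lra.
Qed.

(** On the event of small noise the hypotheses of [leave_one_out] hold. *)
Lemma small_noise_leave_one_out w i : small_noise (s + 1) w ->
  let u := top_vector (leave_out (G w) i) in
  v w i 0 ^+ 4 <= 16 * D ^+ 2 / d ^+ 4 * (\sum_j G w i j * u j 0 ^+ 2) ^+ 2 /\
  fourth_mass u <= 32 * fourth_mass (v w).
Proof.
have [h16 hd hs hsd hp] := ineqs.
move=> gw u.
have tv := graph_top R w n0; have tu := leave_out_top R w i n0.
apply: (leave_one_out n0 (graph_mx_tr R w) _ _ tv tu d0 _ sd (small_noise_opnorm gw)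
  _ Dd2) => //.
- by move=> j k; rewrite graph_mxE; case: (_ && _); [right|left].
- by rewrite graph_mxE eqxx.
- lra.
- by rewrite DE degree_le.
- by move=> y y1; apply: noise_gap p0 gw y1.
Qed.

Lemma large_noise_prob t : s <= t -> E (fun w => (~~ small_noise t w)%:R) <= n%:R^-1.
Proof.
move=> st; apply: le_trans tail; apply: ler_bern_mean => // w.
rewrite /small_noise -ltNge ler_nat; case: (ltP t _) => // h.
by rewrite (le_lt_trans st h).
Qed.

(** The mean [m] of the fourth mass satisfies [m <= m / 2 + (1 + d) / (64 n)],
by [leave_one_out] and the independence of row [i] and of the graph without the
edges at [i]. *)
Lemma delocalization :
  E (fun w => (small_noise (s + 1) w)%:R * fourth_mass (v w)) <= (1 + d) / n%:R.
Proof.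
have [h16 hd hs hsd hp] := ineqs.
set m := E _; set k := 16 * D ^+ 2 / d ^+ 4.
have k0 : 0 <= k by rewrite divr_ge0 ?exprn_ge0 ?(ltW d0) // mulr_ge0 ?sqr_ge0.
pose u i w := top_vector (leave_out (G w) i).
have u1 i w : dot (u i w) (u i w) = 1 by case: (leave_out_top R w i n0).
have ui i w j b : u i (set_coord (edge_key i j) b w) = u i w.
  by rewrite /u leave_out_coord.
have m0 : 0 <= m.
  by apply: bern_mean_ge0 => // w; rewrite mulr_ge0 ?fourth_mass_ge0.
have massu i : E (fun w => fourth_mass (u i w)) <= 32 * m + n%:R^-1.
  apply: (@le_trans _ _ (E (fun w => 32 * ((small_noise (s + 1) w)%:R * fourth_mass (v w)) +
     (~~ small_noise (s + 1) w)%:R))).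
    apply: ler_bern_mean => // w; case: (boolP (small_noise _ w)) => gw /=.
      by rewrite addr0 mul1r; have [_] := small_noise_leave_one_out i gw.
    by rewrite mul0r mulr0 add0r fourth_mass_le1.
  rewrite bern_meanD bern_meanZ -/m lerD2l; apply: large_noise_prob; lra.
have step : m <= \sum_(i < n) k * (p * (32 * m + n%:R^-1) + p ^+ 2).
  have mE : m = \sum_i E (fun w => (small_noise (s + 1) w)%:R * v w i 0 ^+ 4).
    rewrite -bern_mean_sum; apply: eq_bern_mean => w.
    by rewrite /fourth_mass mulr_sumr.
  rewrite {1}mE; apply: ler_sum => i _.
  apply: (@le_trans _ _ (E (fun w => k * (\sum_j G w i j * u i w j 0 ^+ 2) ^+ 2))).
    apply: ler_bern_mean => // w; case: (boolP (small_noise _ w)) => gw.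
      by rewrite mul1r; have [] := small_noise_leave_one_out i gw.
    by rewrite mul0r mulr_ge0 // sqr_ge0.
  rewrite bern_meanZ ler_wpM2l //.
  apply: le_trans (mean_row_sq_le p01 (u1 i) (fun w j b => ui i w j b)) _.
  by rewrite lerD2r ler_wpM2l.
move: step; rewrite sumr_const card_ord -[leRHS]mulr_natl.
have -> : n%:R * (k * (p * (32 * m + n%:R^-1) + p ^+ 2)) =
  k * d * (32 * m + (1 + d) / n%:R).
  by rewrite dE; field; rewrite gt_eqF.
have kd : k * d <= 1 / 64.
  have -> : k * d = 16 * D ^+ 2 / d ^+ 3 by rewrite /k; field; rewrite gt_eqF.
  by rewrite ler_pdivrMr ?exprn_gt0 //; move: Dd3; lra.
have h0 : 0 <= (1 + d) / n%:R by rewrite divr_ge0 ?(ltW np) //; have := ltW d0; lra.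
move=> step.
have : k * d * (32 * m + (1 + d) / n%:R) <= 1 / 64 * (32 * m + (1 + d) / n%:R).
  by rewrite ler_wpM2r // addr_ge0 // mulr_ge0.
lra.
Qed.

(** The bound on the squared effect of the edge [e], expressed with the top
eigenvector at [w]. *)
Definition edge_bound (e : 'I_n * 'I_n) w : R :=
  (small_noise (s + 1) w)%:R * (8 * (v w e.1 0 ^+ 2 * v w e.2 0 ^+ 2) +
    16 / d ^+ 2 * (v w e.1 0 ^+ 4 + v w e.2 0 ^+ 4)).

Lemma graph_mx_set (e : 'I_n * 'I_n) w : (e.1 < e.2)%N ->
  G (set_coord e true w) = G (set_coord e false w) + edge_mx R e.1 e.2.
Proof.
case: e => i j /= ij; have ne : i != j by rewrite -val_eqE /= ltn_eqF.
have ke : edge_key i j = (i, j) by rewrite /edge_key ij.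
apply/matrixP => a b; rewrite [RHS]mxE !graph_mxE !mxE !ffunE -ke edge_key_eq.
have ne' : (i == j) = false by apply/negbTE.
have ne'' : (j == i) = false by rewrite eq_sym.
case: (eqVneq a i) => [->|ai]; case: (eqVneq b j) => [->|bj];
  case: (eqVneq b i) => [bi|bi]; try (case: (eqVneq a j) => [aj|aj]);
  rewrite ?bi ?aj ?eqxx ?ne' ?ne'' ?(negbTE bi) ?(negbTE aj) /= ?addr0 ?add0r ?ne' ?ne'' //=.
Qed.

Lemma edge_diff_ge0 (e : 'I_n * 'I_n) w : (e.1 < e.2)%N ->
  0 <= coord_diff e (fun w => Z w) w.
Proof.
move=> ee; rewrite /coord_diff subr_ge0.
apply: (opnorm_mono n0 (graph_mx_tr R _) (@graph_mx_ge0 R n _)).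
by move=> i j; rewrite graph_mx_set // [leRHS]mxE lerDl !mxE addr_ge0 ?ler0n.
Qed.

(** Removing an edge changes the norm of the noise by at most [1]. *)
Lemma small_noise_set (e : 'I_n * 'I_n) w : (e.1 < e.2)%N -> small_noise s (set_coord e true w) ->
  small_noise (s + 1) (set_coord e false w).
Proof.
have [h16 hd hs hsd hp] := ineqs.
case: e => i j /= ij gw; have ne : i != j by rewrite -val_eqE /= ltn_eqF.
apply: opnorm_quadratic; [lra|exact: sym_mx_tr|move=> x].
have -> : B (set_coord (i, j) false w) = B (set_coord (i, j) true w) - edge_mx R i j.
  apply/matrixP => a b; rewrite [RHS]mxE [X in _ + X]mxE !noise_mxE graph_mx_set //.
  by rewrite [X in _ = X - _ - _]mxE; ring.
set M := B _ in gw *.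
have h1 : `|dot x (M *m x)| <= s * dot x x.
  have : `|dot x (M *m x)| <= opnorm M * dot x x.
    rewrite ler_norml dot_opnorm andbT -lerNl -dotNl.
    apply: le_trans (dot_le_l2norm _ _) _; rewrite -scaleN1r l2normZ normrN1 mul1r.
    rewrite -l2norm_sq expr2 mulrCA ler_wpM2l ?l2norm_ge0 //.
    exact: l2norm_opnorm.
  move=> /le_trans; apply; rewrite ler_wpM2r ?dot_ge0 //.
rewrite mulmxBl dotBr dot_edge_mx mulrDl mul1r.
apply: le_trans (ler_normB _ _) _; apply: lerD h1 _.
apply: le_trans (dot_ge_two x ne).
have := sqr_ge0 (x i 0 - x j 0); have := sqr_ge0 (x i 0 + x j 0).
rewrite ler_norml; lra.
Qed.

(** The squared effect of an edge that is present.  Without control of the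
noise one uses the top eigenvector with the edge, whose contributions still
have a bounded sum; otherwise that of the graph without the edge, which is
independent of it. *)
Lemma edge_diff_sq_le (e : 'I_n * 'I_n) w : (e.1 < e.2)%N -> w e ->
  coord_diff e (fun w => Z w) w ^+ 2 <=
  (~~ small_noise s w)%:R * (4 * (v w e.1 0 ^+ 2 * v w e.2 0 ^+ 2)) +
  edge_bound e (set_coord e false w).
Proof.
have [h16 hd hs hsd hp] := ineqs.
move=> ee we; have D0 := edge_diff_ge0 w ee; move: D0; rewrite /coord_diff.
have wE : set_coord e true w = w by rewrite -we set_coord_id.
rewrite wE; set w0 := set_coord e false w => D0.
have Gw : G w = G w0 + edge_mx R e.1 e.2 by rewrite -graph_mx_set // wE.
case: (boolP (small_noise s w)) => gw; last first.
  rewrite mul1r; apply: (@le_trans _ _ (4 * (v w e.1 0 ^+ 2 * v w e.2 0 ^+ 2))); last first.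
    rewrite lerDl /edge_bound mulr_ge0 // addr_ge0 // mulr_ge0 //.
      by apply: mulr_ge0; exact: sqr_ge0.
      by rewrite divr_ge0 // sqr_ge0.
    by rewrite addr_ge0 // exprn_even_ge0.
  have := opnorm_diff_le (G w0) (graph_top R w n0).
  have -> : G w - G w0 = edge_mx R e.1 e.2 by rewrite Gw addrAC subrr add0r.
  rewrite dot_edge_mx => h.
  have -> : 4 * (v w e.1 0 ^+ 2 * v w e.2 0 ^+ 2) = (2 * v w e.1 0 * v w e.2 0) ^+ 2.
    by ring.
  rewrite ler_sqr ?nnegrE //; first by move: h; set a := _ 0; lra.
  by have [v0 _ _] := graph_top R w n0; rewrite !mulr_ge0.
have gw0 : small_noise (s + 1) w0 by apply: small_noise_set; rewrite ?wE.
rewrite mul0r add0r /edge_bound gw0 mul1r.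
have ne : e.1 != e.2 by rewrite -val_eqE /= ltn_eqF.
have Zd := small_noise_opnorm gw0.
have sl : s + 1 + 1 < Z w0 by lra.
have := opnorm_add_edge n0 ne (graph_mx_tr R w0) (@graph_mx_ge0 R n w0)
  (graph_top R w0 n0) (fun z => small_noise_gap gw0) sl.
rewrite -Gw; set x := v w0 e.1 0; set y := v w0 e.2 0 => h.
have h2 : (x ^+ 2 + y ^+ 2) / (Z w0 - (s + 1) - 1) <= 2 / d * (x ^+ 2 + y ^+ 2).
  rewrite mulrC ler_wpM2r ?addr_ge0 ?sqr_ge0 //.
  have -> : 2 / d = (d / 2)^-1 by rewrite invf_div.
  by rewrite lef_pV2 ?posrE; lra.
have h3 : Z w - Z w0 <= 2 * (x * y) + 2 / d * (x ^+ 2 + y ^+ 2) by lra.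
have h4 : (Z w - Z w0) ^+ 2 <= (2 * (x * y) + 2 / d * (x ^+ 2 + y ^+ 2)) ^+ 2.
  by rewrite ler_sqr ?nnegrE //; apply: le_trans h3.
apply: le_trans h4 _.
have -> : 16 / d ^+ 2 * (x ^+ 4 + y ^+ 4) =
   16 * ((d^-1 * x ^+ 2) ^+ 2 + (d^-1 * y ^+ 2) ^+ 2) by field; rewrite gt_eqF.
have -> : 2 / d * (x ^+ 2 + y ^+ 2) = 2 * (d^-1 * x ^+ 2 + d^-1 * y ^+ 2).
  by field; rewrite gt_eqF.
rewrite -exprMn; move: (x * y) (d^-1 * x ^+ 2) (d^-1 * y ^+ 2) => a b c.
have := sqr_ge0 (2 * a - 2 * (b + c)); have := sqr_ge0 (b - c); lra.
Qed.

(** The contribution of one edge to the Efron-Stein bound. *)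
Lemma edge_influence (e : 'I_n * 'I_n) : (e.1 < e.2)%N ->
  p * (1 - p) * E (fun w => coord_diff e (fun w => Z w) w ^+ 2) <=
  E (fun w => (~~ small_noise s w)%:R * (4 * (v w e.1 0 ^+ 2 * v w e.2 0 ^+ 2))) +
  p * E (edge_bound e).
Proof.
have [h16 hd hs hsd hp] := ineqs.
move=> ee; have /andP[_ p1] := p01.
have q1 : 0 <= 1 - p by lra.
have arith (a b c f : R) : 0 <= b -> p * a <= b + p * c -> (1 - p) * c <= f ->
    p * (1 - p) * a <= b + p * f.
  move=> b0 h1 h2.
  have := ler_wpM2l q1 h1; have := ler_wpM2l hp h2; have := mulr_ge0 hp b0; lra.
have qe : @edge_prob R n p e = p by rewrite /edge_prob ee.
set H := fun w => (~~ small_noise s w)%:R * _.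
have H0 w : 0 <= H w.
  by rewrite /H mulr_ge0 // mulr_ge0 //; apply: mulr_ge0; exact: sqr_ge0.
have b0 w : 0 <= edge_bound e w.
  rewrite /edge_bound mulr_ge0 // addr_ge0 // mulr_ge0 //.
  - by apply: mulr_ge0; exact: sqr_ge0.
  - by rewrite divr_ge0 // sqr_ge0.
  - by rewrite addr_ge0 // exprn_even_ge0.
have h1 : p * E (fun w => coord_diff e (fun w => Z w) w ^+ 2) <=
    E H + p * E (fun w => edge_bound e (set_coord e false w)).
  have coordE g : (forall w b, g (set_coord e b w) = g w) ->
      p * E g = E (fun w => (w e)%:R * g w).
    by move=> ge; rewrite bern_mean_coord ?qe.
  rewrite !coordE; last 2 first.
  - by move=> w b; rewrite set_coordK.
  - by move=> w b; rewrite /coord_diff !set_coordK.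
  rewrite -bern_meanD; apply: ler_bern_mean => // w.
  case: (boolP (w e)) => we; last by rewrite !mul0r addr0.
  by rewrite !mul1r; apply: edge_diff_sq_le.
have h2 : (1 - p) * E (fun w => edge_bound e (set_coord e false w)) <=
    E (edge_bound e).
  rewrite [leRHS](bern_mean_avg _ e) -bern_meanZ; apply: ler_bern_mean => // w.
  by rewrite /coord_avg qe lerDr mulr_ge0.
have EH0 : 0 <= E H by apply: bern_mean_ge0.
exact: arith EH0 h1 h2.
Qed.

(** The Efron-Stein bound, summed over the edges. *)
Lemma finite_variance_le : E (fun w => (Z w - E (fun w => Z w)) ^+ 2) <= 76 * p.
Proof.
have [h16 hd hs hsd hp] := ineqs.
have np1 : n%:R^-1 <= p.
  rewrite -div1r (ler_pdivrMr _ _ np) [p * _]mulrC -dE; lra.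
have arith (X Y W : R) : X <= 1 -> Y <= 64 -> W <= n%:R^-1 ->
    4 * W + p * (8 * X + Y) <= 76 * p.
  move=> X1 Y64 Wn; have : p * (8 * X + Y) <= p * 72 by apply: ler_wpM2l => //; lra.
  lra.
apply: le_trans (efron_stein q01 _) _.
have v1 w : dot (v w) (v w) = 1 by case: (graph_top R w n0).
pose H e w := (~~ small_noise s w)%:R * (4 * (v w e.1 0 ^+ 2 * v w e.2 0 ^+ 2)).
apply: (@le_trans _ _ (\sum_(e : 'I_n * 'I_n) (E (H e) + p * E (edge_bound e)))).
  apply: ler_sum => e _; rewrite /edge_prob; case: ifP => [ee|_].
    exact: edge_influence.
  rewrite !mul0r addr_ge0 // ?mulr_ge0 //; apply: bern_mean_ge0 => // w.
    by rewrite /H mulr_ge0 // mulr_ge0 //; apply: mulr_ge0; exact: sqr_ge0.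
  rewrite /edge_bound mulr_ge0 // addr_ge0 // mulr_ge0 //.
  - by apply: mulr_ge0; exact: sqr_ge0.
  - by rewrite divr_ge0 // sqr_ge0.
  - by rewrite addr_ge0 // exprn_even_ge0.
have sum2 w : \sum_(e : 'I_n * 'I_n) v w e.1 0 ^+ 2 * v w e.2 0 ^+ 2 = 1.
  transitivity (dot (v w) (v w) * dot (v w) (v w)); last by rewrite v1 mulr1.
  rewrite /dot big_distrlr /= pair_big; apply: eq_bigr => e _.
  by rewrite !expr2.
have sum4 w : \sum_(e : 'I_n * 'I_n) (v w e.1 0 ^+ 4 + v w e.2 0 ^+ 4) =
    2 * n%:R * fourth_mass (v w).
  have s1 : \sum_(e : 'I_n * 'I_n) v w e.1 0 ^+ 4 = n%:R * fourth_mass (v w).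
    rewrite -(pair_bigA _ (fun i j : 'I_n => v w i 0 ^+ 4)) /= mulr_sumr.
    by apply: eq_bigr => i _; rewrite sumr_const card_ord mulr_natl.
  have s2 : \sum_(e : 'I_n * 'I_n) v w e.2 0 ^+ 4 = n%:R * fourth_mass (v w).
    rewrite -(pair_bigA _ (fun i j : 'I_n => v w j 0 ^+ 4)) /=.
    by rewrite sumr_const card_ord mulr_natl.
  by rewrite big_split /= s1 s2; ring.
rewrite big_split /= -mulr_sumr -!bern_mean_sum.
have -> : E (fun w => \sum_e H e w) = 4 * E (fun w => (~~ small_noise s w)%:R).
  rewrite -bern_meanZ; apply: eq_bern_mean => w.
  by rewrite /H -mulr_sumr -mulr_sumr sum2 mulr1 mulrC.
have -> : E (fun w => \sum_e edge_bound e w) =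
   E (fun w => 8 * (small_noise (s + 1) w)%:R + 32 * n%:R / d ^+ 2 *
      ((small_noise (s + 1) w)%:R * fourth_mass (v w))).
  apply: eq_bern_mean => w.
  rewrite /edge_bound -mulr_sumr big_split /= -!mulr_sumr sum2 sum4; field.
  by rewrite gt_eqF.
rewrite bern_meanD !bern_meanZ.
have h1 : E (fun w => (small_noise (s + 1) w)%:R) <= 1.
  by rewrite -[leRHS](bern_mean_cst (@edge_prob R n p) 1) ler_bern_mean // => w; case: small_noise.
have h2 := large_noise_prob (lexx s).
have h3 := delocalization.
have c0 : 0 <= 32 * n%:R / d ^+ 2 by rewrite divr_ge0 ?sqr_ge0 // mulr_ge0 ?(ltW np).
have h4 : 32 * n%:R / d ^+ 2 * E (fun w => (small_noise (s + 1) w)%:R * fourth_mass (v w))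
   <= 64.
  apply: (@le_trans _ _ (32 * n%:R / d ^+ 2 * ((1 + d) / n%:R))).
    by rewrite ler_wpM2l.
  have -> : 32 * n%:R / d ^+ 2 * ((1 + d) / n%:R) = 32 * (1 + d) / d ^+ 2.
    by field; rewrite !gt_eqF.
  rewrite ler_pdivrMr ?exprn_gt0 //.
  have : 1 * d <= d * d by rewrite ler_wpM2r ?(ltW d0) //; lra.
  lra.
exact: arith h1 h4 h2.
Qed.

End Variance.

(** * From the random matrix to the finite probability space *)

Section NullSet.
Local Open Scope classical_set_scope.
Local Open Scope ring_scope.
Context d (T : measurableType d) (R : realType) (mu : {measure set T -> \bar R}).
Import HBNNSimple.

(** The functions are not assumed measurable: the integral of a nonnegative
function is a supremum over the simple functions below it, and these can be
cut off on the null set. *)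
Lemma ge0_le_integral_off_null (N : set T) (f g : T -> R) :
  measurable N -> mu N = 0%E -> (forall x, 0 <= f x) -> (forall x, 0 <= g x) ->
  (forall x, ~ N x -> f x <= g x) ->
  (\int[mu]_x (f x)%:E <= \int[mu]_x (g x)%:E)%E.
Proof.
move=> mN N0 f0 g0 fg.
rewrite [leLHS]ge0_integralTE; last by move=> x; rewrite lee_fin.
rewrite [leRHS]ge0_integralTE; last by move=> x; rewrite lee_fin.
apply: ge_ereal_sup => _ [h /= hf <-].
have mCN := measurableC mN.
(* The simple function cut off on [N] has the same integral. *)
pose h' := proj_nnsfun h mCN.
have -> : sintegral mu h = sintegral mu h'.
  rewrite -!integralT_nnsfun; apply: ge0_ae_eq_integral => //.
  - by apply/measurable_EFinP.
  - by apply/measurable_EFinP.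
  - by move=> x _; rewrite lee_fin.
  - by move=> x _; rewrite lee_fin.
  exists N; split => // x /= hx; apply: contrapT => nN; apply: hx => _.
  change ((h x)%:E = (h x * \1_(~` N) x)%:E).
  by rewrite indicE mem_set // mulr1.
apply: ereal_sup_ubound; exists h' => //= x.
change ((h x * \1_(~` N) x)%:E <= (g x)%:E)%E.
rewrite lee_fin indicE; have [xN|nN] := pselect (N x).
  by rewrite memNset ?mulr0 // => /(_ xN).
rewrite mem_set // mulr1; apply: le_trans (fg _ nN).
by rewrite -lee_fin hf.
Qed.

Lemma ge0_eq_integral_off_null (N : set T) (f g : T -> R) :
  measurable N -> mu N = 0%E -> (forall x, 0 <= f x) -> (forall x, 0 <= g x) ->
  (forall x, ~ N x -> f x = g x) ->
  (\int[mu]_x (f x)%:E = \int[mu]_x (g x)%:E)%E.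
Proof.
move=> mN N0 f0 g0 fg; apply/eqP; rewrite eq_le; apply/andP; split.
  by apply: (ge0_le_integral_off_null mN) => // x /fg ->.
by apply: (ge0_le_integral_off_null mN) => // x /fg ->.
Qed.

End NullSet.

Section Bridge.
Local Open Scope classical_set_scope.
Local Open Scope ring_scope.
Context (d : measure_display) (T : measurableType d) (R : realType)
  (P : probability T R) (n : nat) (p : R) (A : 'I_n -> 'I_n -> {RV P >-> R}).
Hypothesis p01 : 0 <= p <= 1.
Hypothesis erA : erdos_renyi_adjacency p A.

(** The edge indicators of the random matrix; an entry different from [1]
counts as absent. *)
Definition edges_of (w : T) : {ffun 'I_n * 'I_n -> bool} :=
  [ffun e : 'I_n * 'I_n => (e.1 < e.2)%N && (A e.1 e.2 w == 1)].

Lemma edge_law (i j : 'I_n) (B : set R) : (i < j)%N -> measurable B ->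
  P (A i j @^-1` B) = (p * (1 \in B)%:R + (1 - p) * (0 \in B)%:R)%:E.
Proof.
move=> ij mB; have := er_law erA ij mB; rewrite /distribution /pushforward => ->.
by rewrite bernoulli_probE // !diracE EFinD !EFinM.
Qed.

(** The set of values of an entry that encodes an edge indicator. *)
Definition edge_value_set (b : bool) : set R := if b then [set 1] else ~` [set 1].

Lemma measurable_edge_value b : measurable (edge_value_set b).
Proof. by case: b => /=; [|apply: measurableC]. Qed.

Lemma edge_value_law (i j : 'I_n) b : (i < j)%N ->
  P (A i j @^-1` edge_value_set b) = (if b then p else 1 - p)%:E.
Proof.
move=> ij; rewrite edge_law //; last exact: measurable_edge_value.
have i1 (x y : R) : (x \in [set y]) = (x == y).
  by apply/idP/eqP => [/set_mem //|->]; apply/mem_set.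
case: b => /=; rewrite ?in_setC !i1 eqxx (eq_sym 0) oner_eq0 /=.
  by rewrite mulr1 mulr0 addr0.
by rewrite mulr1 mulr0 add0r.
Qed.

Let D : {set 'I_n * 'I_n} := [set e : 'I_n * 'I_n | (e.1 < e.2)%N]%SET.

Lemma edges_of_preimage (o : {ffun 'I_n * 'I_n -> bool}) :
  (forall e, o e -> (e.1 < e.2)%N) ->
  edges_of @^-1` [set o] =
  \bigcap_(e in [set` D]) ((fun e => A e.1 e.2 : T -> R) e @^-1` edge_value_set (o e)).
Proof.
move=> oD; apply/seteqP; split => w /=.
  move=> <- e; rewrite /= inE => ee; rewrite ffunE ee /=.
  by case: (A e.1 e.2 w =P 1).
move=> H; apply/ffunP => e; rewrite ffunE.
case: (boolP (e.1 < e.2)%N) => ee /=.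
  have /= := H e; rewrite inE => /(_ ee).
  by case: (o e) => /= [->|/eqP/negbTE]; rewrite ?eqxx.
by symmetry; apply/negbTE; apply: contra ee; exact: oD.
Qed.

Lemma edges_of_measurable o : measurable (edges_of @^-1` [set o]).
Proof.
have [oD|noD] := pselect (forall e, o e -> (e.1 < e.2)%N).
  rewrite edges_of_preimage //; apply: fin_bigcap_measurable => //.
  move=> e _; apply: measurable_funPTI.
  exact: measurable_edge_value.
rewrite (_ : _ @^-1` _ = set0) //; apply/seteqP; split => // w /= ow.
by apply: noD => e; rewrite -ow ffunE => /andP[].
Qed.

(** The edge indicators follow the product Bernoulli measure. *)
Lemma edges_of_law o : P (edges_of @^-1` [set o]) = (bern_weight (@edge_prob R n p) o)%:E.
Proof.
have [oD|noD] := pselect (forall e, o e -> (e.1 < e.2)%N); last first.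
  rewrite (_ : _ @^-1` _ = set0); last first.
    apply/seteqP; split => // w /= ow.
    by apply: noD => e; rewrite -ow ffunE => /andP[].
  rewrite measure0; have [e eP] : exists e, ~ (o e -> (e.1 < e.2)%N) by apply/existsNP.
  have [oe ee] : o e /\ ~~ (e.1 < e.2)%N.
    by case: (boolP (o e)) (boolP (e.1 < e.2)%N) eP => [_|_] [_|_] // H; exfalso; apply: H.
  by rewrite /bern_weight (bigD1 e) //= oe /edge_prob (negbTE ee) mul0r.
rewrite edges_of_preimage //.
have mB e : e \in D -> measurable (edge_value_set (o e)).
  by move=> _; apply: measurable_edge_value.
have := er_indep erA (subxx D) mB; rewrite /mkset => ->.
rewrite /bern_weight [in RHS](bigID (mem D)) /= [X in _ = (_ * X)%:E]big1 ?mulr1.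
  rewrite -prodEFin; apply: eq_bigr => e; rewrite inE => ee.
  by rewrite edge_value_law // /edge_prob ee.
move=> e; rewrite inE => ee; rewrite /edge_prob (negbTE ee) subr0.
by case: ifP => // /oD; rewrite (negbTE ee).
Qed.

Lemma integral_edges_of (F : {ffun 'I_n * 'I_n -> bool} -> R) :
  (forall o, 0 <= F o) ->
  (\int[P]_w (F (edges_of w))%:E = (bern_mean (@edge_prob R n p) F)%:E)%E.
Proof.
move=> F0.
transitivity (\int[P]_w (\sum_(o : {ffun 'I_n * 'I_n -> bool})
    ((F o)%:E * (\1_(edges_of @^-1` [set o]) w)%:E)))%E.
  apply: eq_integral => w _; rewrite (bigD1 (edges_of w)) //=.
  rewrite indicE mem_set // mule1 big1 ?adde0 // => o /eqP ne.
  by rewrite indicE memNset ?mule0 // => /= E; apply: ne.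
have mI o : measurable_fun [set: T] (fun w => (\1_(edges_of @^-1` [set o]) w : R)%:E).
  by apply/measurable_EFinP; apply: measurable_indic; apply: edges_of_measurable.
rewrite ge0_integral_sum //; last 2 first.
- by move=> o; apply: measurable_funeM.
- by move=> o w _; rewrite mule_ge0 // lee_fin.
rewrite /bern_mean -sumEFin; apply: eq_bigr => o _.
rewrite ge0_integralZl_EFin //.
rewrite integral_indic //; last exact: edges_of_measurable.
transitivity ((F o)%:E * (bern_weight (@edge_prob R n p) o)%:E)%E.
  by rewrite setIT; congr (_ * _)%E; exact: edges_of_law.
by rewrite -EFinM mulrC.
Qed.

(** The entries are equal to [0] or [1] only almost surely; this is the null
set where one of them is not. *)
Definition exceptional : set T :=
  \big[setU/set0]_(e : 'I_n * 'I_n | (e.1 < e.2)%N)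
    (A e.1 e.2 @^-1` (~` [set 0; 1])).

Lemma exceptional_measurable : measurable exceptional.
Proof.
apply: bigsetU_measurable => e _; apply: measurable_funPTI; apply: measurableC.
by apply: measurableU.
Qed.

Lemma exceptional_null : P exceptional = 0%E.
Proof.
apply/eqP; rewrite eq_le measure_ge0 andbT.
have mE (e : 'I_n * 'I_n) : measurable (A e.1 e.2 @^-1` (~` [set (0 : R); 1])).
  apply: measurable_funPTI; apply: measurableC.
  by apply: measurableU.
suff [] : measurable exceptional /\ (P exceptional <= 0)%E by [].
rewrite /exceptional; apply: (big_ind (fun S => measurable S /\ (P S <= 0)%E)) => [|S S' [mS S0] [mS' S0']|e ee].
- by rewrite measure0.
- split; first exact: measurableU.
  by apply: le_trans (measureU2 P mS mS') _; rewrite -(adde0 0%E) leeD.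
- split => //; rewrite edge_law //; last by apply: measurableC; apply: measurableU.
  rewrite !in_setC !mem_set /=; [by rewrite !mulr0 addr0|by left|by right].
Qed.

Lemma random_mx_edges w : ~ exceptional w ->
  random_mx A w = graph_mx R (edges_of w).
Proof.
move=> nw; have val01 (i j : 'I_n) : (i < j)%N -> A i j w = (A i j w == 1)%:R.
  move=> ij; have : ~ (A i j @^-1` (~` [set 0; 1])) w.
    by move=> h; apply: nw; rewrite /exceptional (bigD1 (i, j)) //=; left.
  move=> /= /contrapT [->|->]; last by rewrite eqxx.
  by rewrite (negbTE (_ : 0 != 1)) // eq_sym oner_eq0.
apply/matrixP => i j; rewrite !mxE ffunE /edge_key.
have [->|ne] := eqVneq i j; first by rewrite (er_diag erA).
case: (ltnP i j) => ij; first by rewrite /= ij /=; exact: val01.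
have ji : (j < i)%N by rewrite ltn_neqAle ij eq_sym val_eqE ne.
by rewrite /= ji (er_sym erA); exact: val01.
Qed.

(** The variance of the norm is a finite sum over graphs. *)
Lemma variance_opnorm_finite :
  'V_P[fun w => opnorm (random_mx A w)]%E =
  (bern_mean (@edge_prob R n p) (fun o =>
     (opnorm (graph_mx R o) -
        bern_mean (@edge_prob R n p) (fun o => opnorm (graph_mx R o))) ^+ 2))%:E.
Proof.
have mN := exceptional_measurable; have N0 := exceptional_null.
have EX : 'E_P[fun w => opnorm (random_mx A w)]%E =
    (bern_mean (@edge_prob R n p) (fun o => opnorm (graph_mx R o)))%:E.
  rewrite unlock -integral_edges_of; last by move=> o; exact: opnorm_ge0.
  apply: (ge0_eq_integral_off_null mN) => // [w|w|w nw]; rewrite ?opnorm_ge0 //.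
  by rewrite random_mx_edges.
rewrite /variance unlock EX /=.
set m := bern_mean _ _.
rewrite unlock -integral_edges_of; last by move=> o; rewrite sqr_ge0.
apply: (ge0_eq_integral_off_null mN) => // [w|w|w nw]; rewrite ?sqr_ge0 //.
by rewrite -(random_mx_edges nw).
Qed.

End Bridge.

(** * The range of parameters *)

(** From [exp (-1/6) >= 5/6] and [(6/5) ^ 6 < 3]. *)
Lemma expR1_lt3 (R : realType) : expR 1 < 3 :> R.
Proof.
have h1 : 1 - 1 / 6 <= (expR (1 / 6))^-1 :> R.
  by rewrite -expRN; have := expR_ge1Dx (- (1 / 6) : R); lra.
have e0 := expR_gt0 (1 / 6 : R).
have h2 : expR (1 / 6) <= 6 / 5 :> R.
  have : (1 - 1 / 6) * expR (1 / 6) <= 1 :> R by rewrite -ler_pdivlMr // [1 / expR _]div1r.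
  lra.
have -> : expR 1 = expR (1 / 6) ^+ 6 :> R.
  by rewrite -expRM_natl; congr expR; field.
apply: (@le_lt_trans _ _ ((6 / 5) ^+ 6)); last by lra.
by rewrite lerXn2r ?nnegrE ?(ltW e0) //; lra.
Qed.

(** The condition [3 <= n] makes [ln (ln n)] positive. *)
Lemma ln_gt1 (R : realType) (n : nat) : (3 <= n)%N -> 1 < ln n%:R :> R.
Proof.
move=> n3; have n0 : 0 < n%:R :> R by rewrite ltr0n (leq_trans _ n3).
rewrite -[ltLHS](@expRK R) ltr_ln ?posrE ?expR_gt0 //.
have : 3%:R <= n%:R :> R by rewrite ler_nat.
by move=> h; exact: lt_le_trans (expR1_lt3 R) h.
Qed.

(** From [y / 3 <= exp (y / 3)] with [y = ln x]. *)
Lemma ln_cube_le (R : realType) (x : R) : 1 <= x -> ln x ^+ 3 <= 27 * x.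
Proof.
move=> x1; have x0 : 0 < x by lra.
have l0 : 0 <= ln x by rewrite ln_ge0.
have h : ln x / 3 <= expR (ln x / 3) by have := expR_ge1Dx (ln x / 3); lra.
have h3 : (ln x / 3) ^+ 3 <= expR (ln x / 3) ^+ 3.
  by rewrite lerXn2r ?nnegrE ?expR_ge0 //; lra.
have e : expR (ln x / 3) ^+ 3 = x.
  rewrite -expRM_natl (_ : 3%:R * _ = ln x); last by field.
  by rewrite lnK // posrE.
rewrite e in h3; lra.
Qed.

Lemma exists_pow2 (R : realType) (x : R) : 1 <= x ->
  exists m : nat, x <= (2 ^ m.+1)%:R <= 2 * x.
Proof.
move=> x1; have x0 : 0 <= x by lra.
have /andP[h1 h2] := truncn_itv x0; set k := Num.trunc x in h1 h2.
have k0 : (0 < k)%N by rewrite -(ltr_nat R); rewrite -(@ltrD2r _ 1) natr1 /=; lra.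
have /andP[t1 t2] := trunc_log_bounds (isT : 1 < 2)%N k0.
exists (trunc_log 2 k); apply/andP; split.
  by apply: le_trans (ltW h2) _; rewrite ler_nat.
rewrite expnS natrM ler_wpM2l //; apply: le_trans h1.
by rewrite ler_nat.
Qed.

(** The variance is [O(p)] in the range where [n p] is at least a large
multiple of [(ln n) ^ (2/3)]. *)
Lemma variance_opnorm_le (R : realType) : exists2 a : R, 1 <= a &
  forall (n : nat) (p : R) (d : measure_display) (T : measurableType d)
    (P : probability T R) (A : 'I_n -> 'I_n -> {RV P >-> R}),
  (3 <= n)%N -> 0 <= p <= 1 -> a ^+ 3 * ln n%:R ^+ 2 <= (n%:R * p) ^+ 3 ->
  erdos_renyi_adjacency p A ->
  ('V_P[fun w => opnorm (random_mx A w)] <= (76 * p)%:E)%E.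
Proof.
have [K K0 tail] := opnorm_centered_tail R.
(* With [D0 = n p] and [l <= 2 (D0 + L)], the degree bound [D] below is at
   most [Q (D0 + L)], and [a = 4096 Q ^ 2] makes [1024 D ^ 2] at most [D0 ^ 3]. *)
pose Q := 8 * K + 6; have Q6 : 6 <= Q by rewrite /Q; lra.
have Q2 : 36 <= Q ^+ 2.
  by have := ler_pM _ _ Q6 Q6; rewrite expr2 => /(_ ltac:(lra) ltac:(lra)); lra.
pose a := (64 * Q) ^+ 2.
have a1 : 16 <= a by rewrite /a exprMn; lra.
exists a; first by lra.
move=> n p d T P A n3 p01 hd erA; have /andP[p0 p1] := p01.
rewrite (variance_opnorm_finite p01 erA) lee_fin.
set L := ln n%:R in hd; have L1 : 1 < L by exact: ln_gt1.
set D0 := n%:R * p in hd.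
have np : 0 < n%:R :> R by rewrite ltr0n (leq_trans _ n3).
have D00 : 0 <= D0 by rewrite mulr_ge0 // ltW.
have L2 : 1 <= L ^+ 2 by rewrite exprn_ege1 // ltW.
have a3 : 0 <= a ^+ 3 by rewrite exprn_ge0 //; lra.
have Da : a <= D0.
  rewrite -(@ler_pXn2r _ 3) ?nnegrE //; last by lra.
  by apply: le_trans hd; rewrite ler_peMr.
have DL : a * L ^+ 2 <= D0 ^+ 3.
  apply: le_trans hd; rewrite ler_wpM2r //; first by lra.
  by rewrite -[leLHS]expr1 ler_weXn2l //; lra.
have [m /andP[m1 m2]] : exists m : nat, D0 + L <= (2 ^ m.+1)%:R <= 2 * (D0 + L).
  by apply: exists_pow2; lra.
set l : R := (2 ^ m.+1)%:R in m1 m2.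
have l0 : 0 < l by lra.
pose s := Num.sqrt (K * l).
have s2 : s ^+ 2 = K * l by rewrite sqr_sqrtr // mulr_ge0 // ltW.
have s0 : 0 < s by rewrite sqrtr_gt0 mulr_gt0.
have n0 : (0 < n)%N by rewrite (leq_trans _ n3).
have tl : bern_mean (@edge_prob R n p)
    (fun w => (s < opnorm (sym_mx (centered p) w))%R%:R) <= n%:R^-1.
  apply: (tail n m) => //; rewrite -/l ?s2 //; first by rewrite -/D0; lra.
  by rewrite -/L; lra.
pose D := 2 * (s + 1) ^+ 2 + 2 * (p ^+ 2 * n%:R).
have DQ : D <= Q * (D0 + L).
  have h1 : (s + 1) ^+ 2 <= 2 * (K * l) + 2.
    by rewrite -s2; have := sqr_ge0 (s - 1); lra.
  have h2 : K * l <= K * (2 * (D0 + L)) by rewrite ler_wpM2l // ltW.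
  have h3 : p ^+ 2 * n%:R <= D0.
    have -> : p ^+ 2 * n%:R = p * D0 by rewrite /D0; ring.
    by rewrite ler_piMl.
  rewrite /D /Q; lra.
have D_ge0 : 0 <= D.
  by rewrite /D addr_ge0 // mulr_ge0 ?sqr_ge0 // mulr_ge0 ?sqr_ge0 // ltW.
have Dd3 : 1024 * D ^+ 2 <= D0 ^+ 3.
  have h1 : D ^+ 2 <= Q ^+ 2 * (2 * D0 ^+ 2 + 2 * L ^+ 2).
    apply: (@le_trans _ _ ((Q * (D0 + L)) ^+ 2)).
      by rewrite ler_sqr ?nnegrE //; apply: le_trans DQ.
    rewrite exprMn ler_wpM2l ?sqr_ge0 //.
    by have := sqr_ge0 (D0 - L); lra.
  have h2 : a * D0 ^+ 2 <= D0 ^+ 3 by rewrite [leRHS]exprS ler_wpM2r ?sqr_ge0.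
  rewrite /a exprMn in h2 DL; lra.
have D2 : 128 * D <= D0 ^+ 2.
  rewrite -ler_sqr ?nnegrE ?exprn_ge0 ?mulr_ge0 //.
  have h : 16 * D0 ^+ 3 <= D0 ^+ 4.
    by rewrite [leRHS]exprS ler_wpM2r ?exprn_ge0 //; lra.
  have -> : (D0 ^+ 2) ^+ 2 = D0 ^+ 4 by rewrite -exprM.
  apply: le_trans h; have -> : (128 * D) ^+ 2 = 16 * (1024 * D ^+ 2) by ring.
  by rewrite ler_wpM2l.
apply: (@finite_variance_le R n p s D0 D) => //.
- by rewrite -(ler_nat R); apply: (@le_trans _ _ D0); [lra|rewrite ler_piMr // ltW].
- lra.
- exact: ltW.
- apply: ler_of_sqr; first by lra.
  have : 2 * (s + 1) ^+ 2 <= D.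
    by rewrite /D lerDl mulr_ge0 // mulr_ge0 ?sqr_ge0 // ltW.
  have -> : (D0 / 16) ^+ 2 = D0 ^+ 2 / 256 by field.
  lra.
- have := sqr_ge0 D0; lra.
Qed.

Unset Implicit Arguments.
Set Strict Implicit.
Set Printing Implicit Defensive.

Local Open Scope classical_set_scope.
Local Open Scope ring_scope.

Theorem theorem4p5 (R : realType) :
  exists C0 C : R, [/\ 0 < C0, 0 < C,
    (forall (n : nat) (p : R) (d : measure_display) (T : measurableType d)
        (P : probability T R) (A : 'I_n -> 'I_n -> {RV P >-> R}),
      (3 <= n)%N -> p <= 1 / 2 ->
      C0 * ln n%:R / (n%:R * ln (ln n%:R)) <= p ->
      erdos_renyi_adjacency p A ->
      ('V_P[fun w => opnorm (random_mx A w)] <=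
        (C * p * (1 + ln n%:R ^+ 4 / (n%:R * p) ^+ 4))%:E)%E) &
    (forall c : R, 0 < c -> exists Cc : R,
      forall (n : nat) (p : R) (d : measure_display) (T : measurableType d)
        (P : probability T R) (A : 'I_n -> 'I_n -> {RV P >-> R}),
      (3 <= n)%N -> p <= 1 / 2 ->
      C0 * ln n%:R / (n%:R * ln (ln n%:R)) <= p ->
      c * ln n%:R / n%:R <= p ->
      erdos_renyi_adjacency p A ->
      ('V_P[fun w => opnorm (random_mx A w)] <= (Cc * p)%:E)%E)].
Proof.
have [a a1 H] := variance_opnorm_le R.
have a0 : 0 < a by lra.
have param (n : nat) (p : R) : (3 <= n)%N ->
    3 * a * ln n%:R / (n%:R * ln (ln n%:R)) <= p ->
    0 <= p /\ a ^+ 3 * ln n%:R ^+ 2 <= (n%:R * p) ^+ 3.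
  move=> n3; have L1 := ln_gt1 R n3; set L := ln n%:R in L1 *.
  have y0 : 0 < ln L by rewrite ln_gt0.
  have y3 := ln_cube_le (ltW L1); set y := ln L in y0 y3 *.
  have np : 0 < n%:R :> R by rewrite ltr0n (leq_trans _ n3).
  have num0 : 0 <= 3 * a * L by rewrite !mulr_ge0 //; lra.
  rewrite ler_pdivrMr ?mulr_gt0 // => h.
  have p0 : 0 <= p.
    have : 0 <= p * (n%:R * y) by apply: le_trans h.
    by rewrite pmulr_lge0 // mulr_gt0.
  split => //; set D0 := n%:R * p.
  have D00 : 0 <= D0 by rewrite mulr_ge0 // ltW.
  have h3 : (3 * a * L) ^+ 3 <= (D0 * y) ^+ 3.
    have -> : D0 * y = p * (n%:R * y) by rewrite /D0; ring.
    by rewrite lerXn2r ?nnegrE //; apply: le_trans h.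
  have h4 : (D0 * y) ^+ 3 <= D0 ^+ 3 * (27 * L).
    by rewrite exprMn ler_wpM2l // exprn_ge0.
  have Lp : 0 < 27 * L by lra.
  rewrite -(ler_pM2r Lp); apply: le_trans h4; apply: le_trans h3.
  by rewrite le_eqVlt; apply/orP; left; apply/eqP; ring.
exists (3 * a), 76; split => //; first by lra.
- move=> n p d T P A n3 p2 hp erA; have [p0 h] := param n p n3 hp.
  apply: le_trans (H n p d T P A n3 _ h erA) _; first by apply/andP; split; lra.
  rewrite lee_fin ler_peMr //; first by rewrite mulr_ge0.
  rewrite lerDl divr_ge0 // exprn_even_ge0 //.
- move=> c c0; exists 76 => n p d T P A n3 p2 hp _ erA.
  have [p0 h] := param n p n3 hp.
  by apply: (H n p d T P A n3 _ h erA); apply/andP; split; lra.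
Qed.
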